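(* Let $(\mathcal{X},\mathcal{A},P)$ be a probability space, $f\in L_2(P)$ real-valued, and $h=(h_1,\ldots,h_m)^T$ a vector of control variates $h_j\in L_2(P)$ with $P(h_j)=0$ for all $j$. Fix a minimizer $\beta^\star(f)\in\arg\min_{\beta\in\mathbb{R}^m}P[(f-P(f)-\beta^Th)^2]$ and let $\epsilon=f-P(f)-\beta^\star(f)^Th$. Assume: (i) $\epsilon\in\mathcal{G}(\tau^2)$ for some $\tau>0$; (ii) the control variates are uniformly bounded, with $U_h:=\max_{j}\sup_{x\in\mathcal{X}}|h_j(x)|<\infty$; (iii) $h_1,\ldots,h_m$ are linearly independent in $L_2(P)$, so that $G:=P(hh^T)$ is positive definite. Let $B=\sup_{x\in\mathcal{X}}h(x)^TG^{-1}h(x)$. Let $X_1,\ldots,X_n$ be i.i.d. with distribution $P$ and let $\hat\alpha_n^{\mathrm{ols}}(f)$ be the OLS control variate estimator. Then for all $\delta\in(0,1)$ and every integer $n$ with $$n\ge\max\bigl(18B\log(4m/\delta),\;75m\log(4/\delta)\bigr),$$ with probability at least $1-\delta$, $$|\hat\alpha_n^{\mathrm{ols}}(f)-P(f)|\le\sqrt{2\log(8/\delta)}\frac{\tau}{\sqrt n}+58\sqrt{Bm\log(8m/\delta)\log(4/\delta)}\,\frac{\tau}{n}.$$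
   Context: $P(g)=\int g\,dP$ and $P_n(g)=n^{-1}\sum_{i=1}^n g(X_i)$. A centered random variable $Y$ is sub-Gaussian with variance factor $\tau^2$, written $Y\in\mathcal{G}(\tau^2)$, if $\log\mathbb{E}[\exp(\lambda Y)]\le\lambda^2\tau^2/2$ for all $\lambda\in\mathbb{R}$; for a function $\epsilon$ on $\mathcal{X}$, $\epsilon\in\mathcal{G}(\tau^2)$ means $\int\exp\{\lambda\epsilon(x)\}P(dx)\le\exp(\lambda^2\tau^2/2)$ for all $\lambda$. Let $f^{(n)}=(f(X_1),\ldots,f(X_n))^T$, $H=(h_j(X_i))_{i\le n,j\le m}$, $\mathbb{1}_n=(1,\ldots,1)^T$. The OLS estimator is defined by $(\hat\alpha_n^{\mathrm{ols}}(f),\hat\beta_n^{\mathrm{ols}}(f))\in\arg\min_{(\alpha,\beta)\in\mathbb{R}\times\mathbb{R}^m}\|f^{(n)}-\alpha\mathbb{1}_n-H\beta\|_2^2$; equivalently $\hat\alpha_n^{\mathrm{ols}}(f)=P_n[f-\hat\beta_n^{\mathrm{ols}}(f)^Th]$ with $\hat\beta_n^{\mathrm{ols}}(f)\in\arg\min_\beta\|f_c^{(n)}-H_c\beta\|_2^2$, where $f_c^{(n)}=f^{(n)}-\mathbb{1}_n(\mathbb{1}_n^Tf^{(n)})/n$ and $H_c=H-\mathbb{1}_n(\mathbb{1}_n^TH)/n$. *)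

(* Defs.v *)
From HB Require Import structures.
From mathcomp Require Import all_boot all_order all_algebra.
From mathcomp Require Import all_classical all_reals all_analysis.
Set Implicit Arguments. Unset Strict Implicit. Unset Printing Implicit Defensive.
Import Order.TTheory GRing.Theory Num.Theory.
Local Open Scope classical_set_scope.
Local Open Scope ring_scope.

Section Defs.
Context {R : realType} {d : measure_display} {T : measurableType d}.

Definition PE (P : probability T R) (g : T -> R) : R := Rintegral P setT g.

Definition lincomb (m : nat) (beta : 'I_m -> R) (h : 'I_m -> T -> R) (x : T) : R :=
  \sum_(j < m) beta j * h j x.

Definition inL2 (P : probability T R) (g : T -> R) : Prop :=
  measurable_fun setT g /\ P.-integrable setT (fun x => (g x ^+ 2)%:E).

Definition subgaussian_fun (P : probability T R) (eps : T -> R) (tau2 : R) : Prop :=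
  forall lambda : R,
    (\int[P]_x (expR (lambda * eps x))%:E <= (expR (lambda ^+ 2 * tau2 / 2))%:E)%E.

Definition pop_risk (P : probability T R) (f : T -> R) (m : nat)
    (h : 'I_m -> T -> R) (beta : 'I_m -> R) : R :=
  PE P (fun x => (f x - PE P f - lincomb beta h x) ^+ 2).

Definition gram (P : probability T R) (m : nat) (h : 'I_m -> T -> R) : 'M[R]_m :=
  \matrix_(i < m, j < m) PE P (fun x => h i x * h j x).

Definition hvec (m : nat) (h : 'I_m -> T -> R) (x : T) : 'cV[R]_m :=
  \col_(j < m) h j x.

Definition Bconst (P : probability T R) (m : nat) (h : 'I_m -> T -> R) : R :=
  sup (range (fun x => ((hvec h x)^T *m invmx (gram P h) *m hvec h x) ord0 ord0)).

Definition iid_sample {d' : measure_display} {Omega : measurableType d'}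
    (Q : probability Omega R) (P : probability T R) (n : nat)
    (X : 'I_n -> Omega -> T) : Prop :=
  (forall i, measurable_fun setT (X i)) /\
  forall A : 'I_n -> set T, (forall i, measurable (A i)) ->
    Q (\bigcap_(i in [set: 'I_n]) (X i @^-1` A i)) = (\prod_(i < n) P (A i))%E.

Definition ols_obj (n m : nat) (f : T -> R) (h : 'I_m -> T -> R)
    (xs : 'I_n -> T) (alpha : R) (beta : 'I_m -> R) : R :=
  \sum_(i < n) (f (xs i) - alpha - lincomb beta h (xs i)) ^+ 2.

Definition is_ols (n m : nat) (f : T -> R) (h : 'I_m -> T -> R)
    (xs : 'I_n -> T) (alpha : R) (beta : 'I_m -> R) : Prop :=
  forall alpha' beta', ols_obj f h xs alpha beta <= ols_obj f h xs alpha' beta'.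

End Defs.

(* Main.v *)
Require Import Defs.
From HB Require Import structures.
From mathcomp Require Import all_boot all_order all_algebra.
From mathcomp Require Import all_classical all_reals all_analysis.
From mathcomp Require Import measurable_realfun ring lra.
Set Implicit Arguments. Unset Strict Implicit. Unset Printing Implicit Defensive.
Import Order.TTheory GRing.Theory Num.Theory.
Local Open Scope classical_set_scope.
Local Open Scope ring_scope.

(** Let eps be the population residual and y = S h, where S G S^T = 1, so that
    y has identity covariance and |y|^2 = h^T G^-1 h <= B.  Write a for the error
    of the OLS intercept and v, w for the empirical means of y and eps y.  The
    normal equations bound |a - P_n eps| by |v| (|w| + |P_n eps| |v|) / (1/3 - |v|^2)
    as soon as the empirical second moment matrix of y is at least 1/3.  Four
    events, each of probability at least 1 - delta/4, control the ingredients.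
    - P_n eps: Chernoff.
    - w: Chernoff coordinatewise, with a variance proxy kappa_j for eps y_j that
      sums over j to O(B tau^2), so that no factor m is lost.
    - v: for a uniform sign vector u, the mean of exp (s u.S) is a product of
      hyperbolic cosines, which is at least exp (s |S| - 1), while for a fixed u
      the sum u.S is a scalar sum of bounded variables.
    - The second moment matrix: matrix Chernoff, for the potential tr X_n^N with
      X_i = Z_i X_(i-1) Z_i, Z_i = 1 - s y_i y_i^T and s = 1 / (2 B N), which
      replaces tr exp (- 2 s N sum y_i y_i^T).  One step is controlled by
      tr (U V)^N <= tr U^N V^N for N a power of 2, in place of Golden-Thompson. *)

(** * Exponential inequalities *)

Section exp_inequalities.
Context {R : realType}.
Implicit Types x y z r : R.

(** The second-order term of the bound is the product of the sizes of v and w, of orders sqrt(m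
    log(4/delta) / n) and tau sqrt(B log(8m/delta) / n). Union bounds over coordinates for both
    would put m inside both logarithms; the average over signs keeps log m out of the bound on v. As
    eps is unbounded, the exponential moments of eps y_j are expanded with an exponentially weighted
    second moment of eps, which the sub-Gaussian hypothesis controls. The matrix potential is
    polynomial in the sample: its expectation needs neither a matrix exponential nor a spectral
    decomposition, only independence for polynomials in bounded functions. Constants. 75 m
    log(4/delta) <= n gives |v|^2 <= (11/4)^2 / 75, so that 1/3 - |v|^2 >= 93/400. In 18 = 12 * 3/2,
    the 12 keeps the exponents used for eps y_j in range and 3/2 compares log(8m/delta) with
    log(4m/delta). Finally 58 exceeds (11/4) (4 + 9/20) (400/93), where 9/20 pays for the term |P_n
    eps| |v|. *)

Lemma expR_le_inv y : y < 1 -> expR y <= (1 - y)^-1.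
Proof.
move=> y1; rewrite -[expR y]invrK -expRN lef_pV2 ?posrE ?expR_gt0 ?subr_gt0 //.
by have := expR_ge1Dx (- y).
Qed.

Lemma expR_le_inv_sqr y : y < 2 -> expR y <= ((1 - y / 2) ^+ 2)^-1.
Proof.
move=> y2; have -> : expR y = expR (y / 2) ^+ 2.
  by rewrite -expRM_natl; congr expR; lra.
rewrite -exprVn; apply: lerXn2r; rewrite ?nnegrE ?expR_ge0 //.
  by rewrite invr_ge0; lra.
by apply: expR_le_inv; lra.
Qed.

(** Multiplying by [(1 - y / 2) ^+ 2] leaves a polynomial inequality with slack
    [y ^+ 2 / 4 * (1 - 3 * y + y ^+ 2)], whose last factor is positive up to [1 / 3]. It serves
    bounded variables. *)
Lemma expR_le_quad y : y <= 1 / 3 -> expR y <= 1 + y + y ^+ 2.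
Proof.
move=> y3; apply: le_trans (expR_le_inv_sqr _) _; first lra.
rewrite -[X in X <= _]mul1r ler_pdivrMr; last by apply: exprn_gt0; lra.
have -> : (1 + y + y ^+ 2) * (1 - y / 2) ^+ 2 =
  1 + y ^+ 2 / 4 * (1 - 3 * y + y ^+ 2) by field.
by rewrite lerDl mulr_ge0 ?divr_ge0 ?sqr_ge0 //; nra.
Qed.

(** For [y >= 0], the inequality [expR y <= 1 + y * expR y] inserted into itself gives the claim. It
    holds for every [y], as unbounded noise demands; the extra weight is absorbed by
    [weighted_sqr]. *)
Lemma expR_le_quad_expR y : expR y <= 1 + y + y ^+ 2 * expR `|y|.
Proof.
have [y0|y0] := leP 0 y.
  rewrite ger0_norm //; have e0 := expR_gt0 y.
  have : expR y * (1 - y) <= 1.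
    have := expR_ge1Dx (- y); rewrite expRN => h.
    by rewrite -ler_pdivlMl // mulr1.
  move=> h; suff : y * (expR y * (1 - y)) <= y * 1 by nra.
  exact: ler_wpM2l.
apply: le_trans (expR_le_quad _) _; first lra.
by rewrite lerD2l ler_peMr ?sqr_ge0 // -expR0 ler_expR.
Qed.

Lemma expR_ge1D2 x : 0 <= x -> 1 + x + x ^+ 2 / 2 <= expR x.
Proof.
move=> x0; rewrite /expR.
have : nondecreasing_seq (series (exp_coeff x)).
  by apply/nondecreasing_seqP => n; rewrite seriesSr lerDl exp_coeff_ge0.
move=> /nondecreasing_cvgn_le /(_ (is_cvg_series_exp_coeff x) 3%N).
rewrite /series /= !big_nat_recr //= big_geq // /exp_coeff /=.
by rewrite !expr0 expr1 !divr1 add0r.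
Qed.

(** With [y = x / 2], the right side is [1 + (expR y - expR (- y)) ^+ 2 / 2], so it suffices that
    [expR y - expR (- y) >= 2 * y]. *)
Lemma cosh_ge x : 1 + x ^+ 2 / 2 <= (expR x + expR (- x)) / 2.
Proof.
wlog x0 : x / 0 <= x.
  move=> H; have [/H//|x0] := leP 0 x.
  have := H (- x); rewrite opprK sqrrN [expR (- x) + _]addrC; apply; lra.
pose y := x / 2; have y0 : 0 <= y by rewrite /y; lra.
have e0 := expR_gt0 y; have := expR_ge1D2 y0.
set p := 1 + y + _ => pe.
have p0 : 0 < p by rewrite /p; nra.
have q : expR y * expR (- y) = 1 by rewrite -expRD subrr expR0.
have em0 := expR_gt0 (- y).
have em : expR (- y) <= p^-1.
  by rewrite expRN lef_pV2 ?posrE.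
have h : 2 * y <= expR y - expR (- y).
  (* [p] is a lower bound of [expR y], and [p ^+ 2 - 1 - 2 * y * p] is exactly [y ^+ 4 / 4]. *)
  suff : 2 * y <= p - p^-1 by lra.
  rewrite -(ler_pM2r p0) mulrBl mulVf ?gt_eqF //.
  have : p * p - 1 - 2 * y * p = y ^+ 4 / 4 by rewrite /p; field.
  have : 0 <= y ^+ 4 / 4 by rewrite divr_ge0 // exprn_even_ge0.
  lra.
have -> : expR x = expR y ^+ 2 by rewrite -expRM_natl /y; congr expR; field.
have -> : expR (- x) = expR (- y) ^+ 2.
  by rewrite -expRM_natl /y; congr expR; field.
have -> : x = 2 * y by rewrite /y; field.
have : (2 * y) ^+ 2 <= (expR y - expR (- y)) ^+ 2.
  by apply: lerXn2r; rewrite ?nnegrE //; lra.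
nra.
Qed.

Lemma expR1_ge52 : 5 / 2 <= expR 1 :> R.
Proof. by have := @expR_ge1D2 1 ler01; rewrite expr1n; lra. Qed.

(** The exponent is linear in [x ^+ 2] and equals [r - 1] at [x = r], so that such bounds multiply
    over coordinates with a given sum of squares. The threshold [11 / 3] is [11 / 4 * (4 / 3)], the
    least value of [r] in [mean_tail]. *)
Lemma cosh_ge_expR_chord r x : 11 / 3 <= r -> `|x| <= r ->
  expR (x ^+ 2 * ((r - 1) / r ^+ 2)) <= (expR x + expR (- x)) / 2.
Proof.
move=> r0 xr; wlog x0 : x xr / 0 <= x.
  move=> H; have [/H->//|x0] := leP 0 x.
  have := H (- x); rewrite normrN opprK sqrrN [expR (- x) + _]addrC; apply => //; lra.
rewrite ger0_norm // in xr.
pose t := r^-1; have rp : 0 < r by lra.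
have t0 : 0 < t by rewrite invr_gt0.
have rt : r * t = 1 by rewrite divff // gt_eqF.
have -> : (r - 1) / r ^+ 2 = t - t ^+ 2 by rewrite /t; field; rewrite gt_eqF.
have t3 : t <= 3 / 11 by nra.
(* Up to 2 the coefficient [t - t ^+ 2] is at most [1 / 5], and [1 + x ^+ 2 / 2] suffices. Beyond 2
   the exponent [x * u - u ^+ 2], with [u = x * t <= 1], is at most [x - 1], and
   [expR (x - 1) <= expR x / 2]. *)
have [x2|x2] := leP x 2.
  apply: le_trans (cosh_ge x).
  set z := x ^+ 2 * _.
  have tt : t - t ^+ 2 <= 1 / 5 by nra.
  have x24 : 0 <= x ^+ 2 <= 4 by rewrite sqr_ge0 /=; nra.
  have z15 : z <= x ^+ 2 / 5 by rewrite /z; nra.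
  apply: (@le_trans _ _ (expR (x ^+ 2 / 5))); first by rewrite ler_expR.
  set w := x ^+ 2 / 5; have wb : 0 <= w <= 4 / 5 by rewrite /w; lra.
  have -> : x ^+ 2 / 2 = 5 / 2 * w by rewrite /w; field.
  apply: le_trans (expR_le_inv_sqr _) _; first lra.
  rewrite -[X in X <= _]mul1r ler_pdivrMr; last by apply: exprn_gt0; lra.
  have -> : (1 + 5 / 2 * w) * (1 - w / 2) ^+ 2 =
    1 + w * (3 / 2 - 9 / 4 * w + 5 / 8 * w ^+ 2) by field.
  rewrite lerDl mulr_ge0 //; first lra.
  by nra.
have xt : x * t <= 1 by rewrite -rt ler_pM2r.
apply: (@le_trans _ _ (expR (x - 1))).
  rewrite ler_expR.
  have -> : x ^+ 2 * (t - t ^+ 2) = x * (x * t) - (x * t) ^+ 2 by ring.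
  set u := x * t in xt *; nra.
rewrite expRB ler_pdivrMr ?expR_gt0 //.
have := expR1_ge52; have := expR_gt0 x; have := expR_gt0 (- x); nra.
Qed.

(** The square is traded for an exponential through [z <= expR (z - 1)] at [z = 3 / 5 * |y|]; the
    exponents add up as [2 * (3 / 5) + 3 / 10 = 3 / 2]. *)
Lemma sqr_mul_expR_le y :
  y ^+ 2 * expR (3 / 10 * `|y|) <= 25 / 9 * expR (-2) * expR (3 / 2 * `|y|).
Proof.
set a := `|y|; have a0 : 0 <= a by exact: normr_ge0.
have -> : y ^+ 2 = a ^+ 2 by rewrite real_normK // num_real.
have h : (3 / 5 * a) ^+ 2 <= expR (3 / 5 * a - 1) ^+ 2.
  apply: lerXn2r; rewrite ?nnegrE ?expR_ge0 //; first lra.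
  by have := expR_ge1Dx (3 / 5 * a - 1); lra.
have -> : expR (3 / 2 * a) = expR (3 / 5 * a) ^+ 2 * expR (3 / 10 * a).
  by rewrite -expRM_natl -expRD; congr expR; lra.
rewrite mulrA ler_pM2r ?expR_gt0 //.
move: h; rewrite -!expRM_natl.
rewrite (_ : 2%:R * (3 / 5 * a - 1) = -2 + 2%:R * (3 / 5 * a)); last by lra.
rewrite expRD; lra.
Qed.

(** It bounds [ln (4 / delta)] from below for every [delta < 1]. The bound [15 / 14] on
    [expR (1 / 15)] is raised to the power 20 along the chain 1, 2, 4, 5, 10, 20, rounded up to a
    small fraction each time so that it ends at [2 * 2]. *)
Lemma ln4_ge : 4 / 3 <= ln 4 :> R.
Proof.
rewrite -ler_expR lnK ?posrE //.
have -> : 4 / 3 = 20%:R * (1 / 15) :> R by lra.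
rewrite expRM_natl.
have h : expR (1 / 15) <= 15 / 14 :> R.
  apply: le_trans (expR_le_inv _) _; first lra.
  by rewrite (_ : 1 - 1 / 15 = 14 / 15) ?invf_div //; lra.
have e0 := expR_ge0 (1 / 15 : R); move: (expR _) e0 h => e e0 h.
have step (k l : nat) (b c : R) : e ^+ k <= b -> e ^+ l <= c -> e ^+ (k + l) <= b * c.
  by move=> hb hc; rewrite exprD; apply: ler_pM; rewrite ?exprn_ge0.
have h2 : e ^+ 2 <= 31 / 27 by apply: le_trans (step 1%N 1%N _ _ h h) _; lra.
have h4 : e ^+ 4 <= 62 / 47 by apply: le_trans (step 2%N 2%N _ _ h2 h2) _; lra.
have h5 : e ^+ 5 <= 41 / 29 by apply: le_trans (step 1%N 4%N _ _ h h4) _; lra.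
have h10 : e ^+ 10 <= 2 by apply: le_trans (step 5%N 5%N _ _ h5 h5) _; lra.
by apply: le_trans (step 10%N 10%N _ _ h10 h10) _; lra.
Qed.

Lemma expR_le_inv1B z : 0 <= z -> z <= 1 / 10 -> expR (- (10 / 9 * z)) <= 1 - z.
Proof.
move=> z0 z1; have z2 : 0 < 1 - z by lra.
rewrite expRN -[1 - z]invrK lef_pV2 ?posrE ?expR_gt0 ?invr_gt0 //.
apply: le_trans (expR_ge1Dx _).
rewrite -[X in X <= _]mul1r ler_pdivrMr //; nra.
Qed.

End exp_inequalities.

(** * Trace inequalities *)

Section trace_inequalities.
Context {R : realFieldType} {m : nat}.
Implicit Types A C U V : 'M[R]_m.

Lemma mxtrace_mul_tr_ge0 A : 0 <= \tr (A *m A^T).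
Proof.
rewrite sumr_ge0 // => i _; rewrite mxE sumr_ge0 // => j _.
by rewrite mxE -expr2 sqr_ge0.
Qed.

Lemma trmxX A n : (A ^+ n)^T = A^T ^+ n.
Proof.
elim: n => [|n IHn]; first by rewrite !expr0 trmx1.
by rewrite exprS exprSr trmx_mul IHn.
Qed.

Lemma mxtrace_mulXC U V n : (0 < n)%N -> \tr ((U * V) ^+ n) = \tr ((V * U) ^+ n).
Proof.
case: n => // n _; rewrite exprS -mulrA mxtrace_mulC.
suff -> : (V * (U * V) ^+ n) *m U = (V * U) ^+ n.+1 by [].
elim: n => [|n IHn]; first by rewrite expr0 mulr1 expr1.
by rewrite [in RHS]exprS -IHn exprS -!mulmxE !mulmxA.
Qed.

Lemma mxtraceB A C : \tr (A - C) = \tr A - \tr C.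
Proof. exact: raddfB. Qed.

Lemma mxtrace_sqr_le C : \tr (C * C) <= \tr (C * C^T).
Proof.
have := mxtrace_mul_tr_ge0 (C - C^T).
rewrite linearB /= trmxK mulmxBl !mulmxBr !mxtraceB.
rewrite -(mxtrace_tr (C^T *m C^T)) trmx_mul trmxK (mxtrace_mulC C^T C) !mulmxE; lra.
Qed.

Lemma mxtrace_mul_le_half U V : U^T = U -> V^T = V ->
  \tr (U * V) <= (\tr (U * U) + \tr (V * V)) / 2.
Proof.
move=> sU sV; have := mxtrace_mul_tr_ge0 (U - V).
rewrite linearB /= sU sV mulmxBl !mulmxBr !mxtraceB.
rewrite (mxtrace_mulC V U) !mulmxE; lra.
Qed.

(* The two inequalities feed each other: the first at [p] applied to [C ^+ 2]
   and the second at [p] give the first at [2p], and similarly for the second. *)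
Lemma mxtrace_power_ineqs k :
  (forall C, \tr (C ^+ (2 * 2 ^ k)) <= \tr ((C * C^T) ^+ (2 ^ k))) /\
  (forall U V, U^T = U -> V^T = V ->
    \tr ((U * V) ^+ (2 ^ k)) <= \tr (U ^+ (2 ^ k) * V ^+ (2 ^ k))).
Proof.
elim: k => [|k [IHC IHUV]].
  split=> [C|U V _ _]; last by rewrite expn0 !expr1.
  by rewrite expn0 muln1 expr1 expr2 mxtrace_sqr_le.
have p0 : (0 < 2 ^ k)%N by rewrite expn_gt0.
rewrite expnS; set p := (2 ^ k)%N in IHC IHUV p0 *.
split=> [C|U V sU sV].
  have sCC : (C * C^T)^T = C * C^T by rewrite trmx_mul trmxK.
  have sCC' : (C^T * C)^T = C^T * C by rewrite trmx_mul trmxK.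
  rewrite [X in \tr X <= _]exprM; apply: le_trans (IHC _) _.
  have -> : C ^+ 2 * (C ^+ 2)^T = C * (C * C^T * C^T).
    by rewrite expr2 trmx_mul mulmxE !mulrA.
  rewrite mxtrace_mulXC // -[C * C^T * C^T * C]mulrA.
  apply: le_trans (IHUV _ _ sCC sCC') _.
  apply: le_trans (mxtrace_mul_le_half _ _) _; rewrite ?trmxX ?sCC ?sCC' //.
  rewrite -!exprD addnn -mul2n (mxtrace_mulXC C^T C) ?muln_gt0 //; lra.
apply: le_trans (IHC _) _.
rewrite trmx_mul sU sV mulmxE -[U * V * (V * U)]mulrA mxtrace_mulXC //.
have -> : V * (V * U) * U = V ^+ 2 * U ^+ 2 by rewrite !expr2 !mulrA.
rewrite mxtrace_mulXC //.
rewrite !(exprM _ 2%N).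
by apply: IHUV; rewrite trmxX ?sU ?sV.
Qed.

Lemma mxtrace_mulX_le k U V : U^T = U -> V^T = V ->
  \tr ((U * V) ^+ (2 ^ k)) <= \tr (U ^+ (2 ^ k) * V ^+ (2 ^ k)).
Proof. exact: (mxtrace_power_ineqs k).2. Qed.

End trace_inequalities.

(** * Products of rank-one contractions *)

Lemma sum_mul_sqr_le (R : realFieldType) (m : nat) (a b : 'I_m -> R) :
  (\sum_i a i * b i) ^+ 2 <= (\sum_i a i ^+ 2) * (\sum_i b i ^+ 2).
Proof.
have b2 : 0 <= \sum_i b i ^+ 2 by apply: sumr_ge0 => i _; exact: sqr_ge0.
set A := \sum_i a i ^+ 2; set B := \sum_i b i ^+ 2 in b2 *; set C := \sum_i _ * _.
have [B0|B0] := eqVneq B 0.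
  have bi i : b i = 0.
    apply/eqP; rewrite -sqrf_eq0.
    by rewrite (psumr_eq0P (fun i _ => sqr_ge0 (b i)) B0).
  by rewrite /C big1 ?expr0n ?B0 ?mulr0 // => i _; rewrite bi mulr0.
have Bp : 0 < B by rewrite lt_def B0.
have E p q : \sum_i (p * a i - q * b i) ^+ 2 = p ^+ 2 * A - 2 * p * q * C + q ^+ 2 * B.
  rewrite /A /B /C !mulr_sumr -sumrB -big_split /=.
  by apply: eq_bigr => i _; ring.
have : 0 <= \sum_i (B * a i - C * b i) ^+ 2 by apply: sumr_ge0 => i _; exact: sqr_ge0.
rewrite E.
move=> h; have {}h : 0 <= B * (B * A - C ^+ 2) by apply: le_trans h _; lra.
by rewrite pmulr_rge0 // subr_ge0 mulrC in h.
Qed.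

Section deflation.
Context {R : realFieldType} {m : nat}.
Implicit Types (x y u v w : 'cV[R]_m) (X Z : 'M[R]_m) (s : R).

Definition dotp u v : R := \sum_i u i ord0 * v i ord0.

Lemma dotpC u v : dotp u v = dotp v u.
Proof. by apply: eq_bigr => i _; rewrite mulrC. Qed.

Lemma dotpBr u v w : dotp u (v - w) = dotp u v - dotp u w.
Proof. by rewrite -sumrB; apply: eq_bigr => i _; rewrite !mxE mulrBr. Qed.

Lemma dotpBl u v w : dotp (v - w) u = dotp v u - dotp w u.
Proof. by rewrite dotpC dotpBr !(dotpC u). Qed.

Lemma dotpZr a u v : dotp u (a *: v) = a * dotp u v.
Proof. by rewrite /dotp mulr_sumr; apply: eq_bigr => i _; rewrite !mxE mulrCA. Qed.

Lemma dotpZl a u v : dotp (a *: v) u = a * dotp v u.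
Proof. by rewrite dotpC dotpZr dotpC. Qed.

Lemma dotpE u v : u^T *m v = (dotp u v)%:M.
Proof.
apply/matrixP => i j; rewrite !ord1 mxE mxE eqxx mulr1n.
by apply: eq_bigr => k _; rewrite mxE.
Qed.

Lemma dotp_ge0 u : 0 <= dotp u u.
Proof. by apply: sumr_ge0 => i _; rewrite -expr2 sqr_ge0. Qed.

Lemma dotp_sqr_le u v : dotp u v ^+ 2 <= dotp u u * dotp v v.
Proof. exact: sum_mul_sqr_le. Qed.

Lemma normr_dotp_le u v (a b : R) : 0 <= a -> 0 <= b ->
  dotp u u <= a ^+ 2 -> dotp v v <= b ^+ 2 -> `|dotp u v| <= a * b.
Proof.
move=> a0 b0 ua vb; rewrite -ler_sqr ?nnegrE ?mulr_ge0 //.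
rewrite real_normK ?num_real // exprMn.
apply: le_trans (dotp_sqr_le u v) _.
by apply: ler_pM; rewrite ?dotp_ge0.
Qed.

Lemma dotp_mulmx X u v : dotp u (X *m v) = dotp (X^T *m u) v.
Proof.
have : (u^T *m (X *m v)) ord0 ord0 = ((X^T *m u)^T *m v) ord0 ord0.
  by rewrite trmx_mul trmxK mulmxA.
by rewrite !dotpE !mxE eqxx !mulr1n.
Qed.

Lemma mxtrace_outer X x : \tr (X * (x *m x^T)) = dotp x (X *m x).
Proof.
by rewrite -mulmxE mulmxA mxtrace_mulC dotpE mxtrace_scalar.
Qed.

Definition deflation s x : 'M[R]_m := 1 - s *: (x *m x^T).

Lemma deflationT s x : (deflation s x)^T = deflation s x.
Proof. by rewrite /deflation linearB linearZ /= trmx1 trmx_mul trmxK. Qed.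

Lemma outer_sqr x : (x *m x^T) * (x *m x^T) = dotp x x *: (x *m x^T).
Proof.
by rewrite -mulmxE mulmxA -(mulmxA x) dotpE mul_mx_scalar -scalemxAl.
Qed.

Lemma mul_deflation_vec s x y : deflation s x *m y = y - (s * dotp x y) *: x.
Proof.
rewrite /deflation mulmxBl mul1mx -scalemxAl -mulmxA dotpE mul_mx_scalar scalerA.
by rewrite mulrC.
Qed.

(** Powers stay of the form [deflation] because [x *m x^T] squares to a multiple of itself. The
    geometric sum avoids dividing by [dotp x x], which may vanish. *)
Lemma deflationX s x j :
  deflation s x ^+ j = deflation (s * \sum_(i < j) (1 - s * dotp x x) ^+ i) x.
Proof.
elim: j => [|j IHj].
  by rewrite big_ord0 mulr0 /deflation scale0r subr0 expr0.
have E (q : R) : \sum_(i < j.+1) q ^+ i = 1 + q * \sum_(i < j) q ^+ i.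
  rewrite big_ord_recl expr0 mulr_sumr; congr (_ + _).
  by apply: eq_bigr => i _; exact: exprS.
rewrite exprS IHj E; set S := \sum_(i < j) _.
rewrite /deflation mulrBl mul1r mulrBr mulr1 -!mulmxE -scalemxAl -scalemxAr mulmxE outer_sqr !scalerA.
by move: (x *m x^T) => Y; apply/matrixP => p q; rewrite !mxE; ring.
Qed.

(** By cyclicity the left side is the trace of [(X * Z ^+ 2) ^+ N], with [Z] the deflation and
    [N = 2 ^ k], hence at most that of [X ^+ N * Z ^+ (2 * N)]. The result is linear in [x *m x^T],
    so its mean can be taken. As [N] is even, [X ^+ N] is a square and its trace against [x *m x^T]
    is nonnegative, which allows [dotp x x] to be replaced by [b]. *)
Lemma mxtrace_deflation_step s b x X k : (0 < k)%N -> 0 <= s -> s * b <= 1 ->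
  dotp x x <= b -> X^T = X ->
  \tr ((deflation s x * X * deflation s x) ^+ (2 ^ k)) <=
  \tr (X ^+ (2 ^ k)) -
  s * (\sum_(i < 2 * 2 ^ k) (1 - s * b) ^+ i) * \tr (X ^+ (2 ^ k) * (x *m x^T)).
Proof.
move=> k0 s0 sb xb sX; rewrite -mulrA mxtrace_mulXC ?expn_gt0 //.
rewrite -mulrA -expr2; apply: le_trans (mxtrace_mulX_le _ _ _) _ => //.
  by rewrite trmxX deflationT.
rewrite -exprM deflationX /deflation mulrBr mulr1 -!mulmxE -scalemxAr mxtraceB mxtraceZ lerB //.
apply: ler_wpM2r.
  rewrite mxtrace_outer; case: k k0 => // k _.
  rewrite expnS mulnC exprM expr2 -mulmxE -mulmxA dotp_mulmx trmxX sX.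
  exact: dotp_ge0.
apply: ler_wpM2l => //; apply: ler_sum => i _; apply: lerXn2r.
- by rewrite nnegrE; lra.
- by rewrite nnegrE; have := ler_wpM2l s0 xb; lra.
- by have := ler_wpM2l s0 xb; lra.
Qed.

(** Jensen's inequality for the spectral measure of [X] at [v], obtained without a spectrum:
    Cauchy-Schwarz is the case of exponent 2, and doubling does the rest. *)
Lemma dotp_mulX_le X v k : X^T = X -> dotp v v = 1 ->
  (dotp v (X *m v)) ^+ (2 ^ k) <= dotp v (X ^+ (2 ^ k) *m v).
Proof.
move=> + v1; elim: k X => [|k IHk] X sX; first by rewrite expn0 !expr1.
rewrite expnS !exprM; apply: le_trans (IHk (X ^+ 2) _); last by rewrite trmxX sX.
apply: lerXn2r; rewrite ?nnegrE ?sqr_ge0 //.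
  by rewrite expr2 -mulmxE -mulmxA dotp_mulmx sX dotp_ge0.
apply: le_trans (dotp_sqr_le _ _) _.
by rewrite v1 mul1r expr2 -mulmxE -mulmxA [leRHS]dotp_mulmx sX.
Qed.

(** The even power is [W * W] with [W] symmetric, so its form at [v] is the squared norm of
    [W *m v], at most the squared Frobenius norm of [W]. *)
Lemma dotp_mul_le_mxtrace X v k : (0 < k)%N -> X^T = X -> dotp v v = 1 ->
  (dotp v (X *m v)) ^+ (2 ^ k) <= \tr (X ^+ (2 ^ k)).
Proof.
move=> k0 sX v1; apply: le_trans (dotp_mulX_le _ sX v1) _.
case: k k0 => // k _; rewrite expnS mulnC exprM expr2.
have : (X ^+ (2 ^ k))^T = X ^+ (2 ^ k) by rewrite trmxX sX.
move: (X ^+ _) => W sW.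
rewrite -mulmxE -mulmxA dotp_mulmx sW.
have -> : \tr (W *m W) = \tr (W *m W^T) by rewrite sW.
rewrite /mxtrace; apply: ler_sum => i _; rewrite !mxE -expr2.
apply: le_trans (sum_mul_sqr_le _ _) _.
rewrite [X in _ * X](_ : _ = 1) ?mulr1; last first.
  by rewrite -v1; apply: eq_bigr => j _; rewrite expr2.
by apply: ler_sum => j _; rewrite mxE expr2.
Qed.

Fixpoint deflation_prod s (xs : seq 'cV[R]_m) : 'M[R]_m :=
  if xs is x :: xs' then deflation s x * deflation_prod s xs' else 1.

(** Each new vector conjugates the product built so far from outside, so that one sample is one step
    of the recursion on the potential and the inner matrix does not depend on it. *)
Fixpoint deflation_sym s (xs : seq 'cV[R]_m) : 'M[R]_m :=
  if xs is x :: xs' then deflation s x * deflation_sym s xs' * deflation s x else 1.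

Lemma deflation_symE s xs : deflation_sym s xs = deflation_prod s xs * (deflation_prod s xs)^T.
Proof.
elim: xs => [|x xs IH] /=; first by rewrite trmx1 mulr1.
by rewrite IH trmx_mul deflationT mulmxE !mulrA.
Qed.

Lemma deflation_symT s xs : (deflation_sym s xs)^T = deflation_sym s xs.
Proof. by rewrite deflation_symE trmx_mul trmxK. Qed.

Section first_order.
Variables (s b : R) (v : 'cV[R]_m).
Hypotheses (s0 : 0 <= s) (b0 : 0 <= b) (sb : s * b ^+ 2 <= 1) (v1 : dotp v v = 1).

Let bnd (xs : seq 'cV[R]_m) := forall x, x \in xs -> dotp x x <= b ^+ 2.

Let bnd_cons x xs : bnd (x :: xs) -> dotp x x <= b ^+ 2 /\ bnd xs.
Proof.
move=> h; split; first by apply: h; rewrite mem_head.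
by move=> y yx; apply: h; rewrite in_cons yx orbT.
Qed.

Lemma deflation_prod_contract xs : bnd xs -> dotp (deflation_prod s xs *m v) (deflation_prod s xs *m v) <= 1.
Proof.
elim: xs => [|x xs IH] /=; first by rewrite mul1mx v1.
move=> /bnd_cons [xb /IH]; apply: le_trans.
rewrite -mulmxE -mulmxA; set y := deflation_prod _ _ *m v.
rewrite mul_deflation_vec dotpBr !dotpBl !dotpZr !dotpZl (dotpC y x).
have : 0 <= s * (2 - s * dotp x x) * dotp x y ^+ 2.
  have sx : s * dotp x x <= 1 by apply: le_trans sb; apply: ler_wpM2l.
  by rewrite mulr_ge0 ?sqr_ge0 // mulr_ge0 //; lra.
lra.
Qed.

Lemma deflation_prod_drift xs w : bnd xs -> dotp w w <= b ^+ 2 ->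
  `|dotp w (deflation_prod s xs *m v - v)| <= s * b ^+ 3 * (size xs)%:R.
Proof.
move=> + wb; elim: xs => [|x xs IH] /=.
  by rewrite mul1mx subrr -(scale0r 0) dotpZr mul0r normr0 mulr0.
move=> /bnd_cons [xb xsb]; rewrite -mulmxE -mulmxA mul_deflation_vec.
have := deflation_prod_contract xsb; move: (IH xsb); set y := deflation_prod _ _ *m v => h1 h2.
rewrite addrAC dotpBr dotpZr -natr1 mulrDr mulr1.
apply: le_trans (ler_normB _ _) _; apply: lerD => //.
rewrite !normrM ger0_norm // -mulrA ler_wpM2l // (_ : b ^+ 3 = b * b ^+ 2); last by ring.
apply: ler_pM; rewrite ?normr_ge0 //; last first.
  by rewrite expr2; apply: normr_dotp_le.
by rewrite -[b]mulr1; apply: normr_dotp_le; rewrite // expr1n.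
Qed.

(** Each factor removes [s * dotp v x * dotp x y], where [y] is the current image of [v]. Replacing
    [y] by [v] gives the first-order term, and the drift of [y] costs at most [s ^+ 2 * b ^+ 4 * k]
    at the step preceded by [k] factors; the sum over steps is of second order in [s * size xs]. *)
Lemma deflation_prod_first_order xs : bnd xs ->
  1 - s * (\sum_(x <- xs) dotp x v ^+ 2 + s * b ^+ 4 * (size xs)%:R ^+ 2) <=
  dotp v (deflation_prod s xs *m v).
Proof.
elim: xs => [|x xs IH] /=.
  by rewrite big_nil mul1mx v1 expr0n /= mulr0 addr0 mulr0 subr0.
move=> /bnd_cons [xb xsb]; rewrite -mulmxE -mulmxA mul_deflation_vec big_cons.
move: (IH xsb) (deflation_prod_drift xsb xb); set y := deflation_prod _ _ *m v => h1 h2.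
rewrite dotpBr dotpZr.
have xv : `|dotp x v| <= b.
  by rewrite -[b]mulr1; apply: normr_dotp_le; rewrite // ?expr1n ?v1.
have : dotp x v * dotp x (y - v) <= b * (s * b ^+ 3 * (size xs)%:R).
  by apply: le_trans (ler_norm _) _; rewrite normrM; apply: ler_pM.
rewrite dotpBr mulrBr (dotpC v x) => h3.
rewrite -natr1; set k : R := (size xs)%:R in h1 h3 *; have k0 : 0 <= k by [].
have : s * (dotp x v * dotp x y - dotp x v * dotp x v) <= s * (b * (s * b ^+ 3 * k)).
  exact: ler_wpM2l.
have : 0 <= s * s * b ^+ 4 * (k + 1) by rewrite !mulr_ge0 ?exprn_ge0 //; lra.
rewrite /y in h1 h3 *; lra.
Qed.

End first_order.

End deflation.

Section lower_eigenvalue.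
Context {R : realType} {m : nat}.

(* [deflation_sym s xs ^+ N] is a stand-in for [expR (- 2 s N \sum x x^T)], which it
   approaches as [N] grows with [s N] fixed; here [2 s N = 1 / B]. *)
Lemma mxtrace_deflation_sym_ge (B : R) (xs : seq 'cV[R]_m) (v : 'cV[R]_m) k :
  let n := size xs in let N := (2 ^ k)%N in
  1 <= B -> (0 < n)%N -> (10 * n ^ 2 <= N)%N ->
  (forall x, x \in xs -> dotp x x <= B) ->
  dotp v v = 1 -> \sum_(x <- xs) dotp x v ^+ 2 <= n%:R / 3 ->
  expR (- (10 / 27 * (n%:R / B) + 1 / 18)) <=
  \tr (deflation_sym (2 * B * N%:R)^-1 xs ^+ N).
Proof.
move=> n N B1 n0 nN xsB v1 rho.
have k0 : (0 < k)%N.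
  rewrite lt0n; apply: contraTneq nN => k0; rewrite /N k0 -ltnNge.
  by rewrite (@leq_trans (10 * 1)) // leq_mul2l /= sqrn_gt0.
set s : R := (2 * B * N%:R)^-1.
have n1 : 1 <= n%:R :> R by rewrite ler1n.
have N1 : 10 * n%:R ^+ 2 <= N%:R :> R by rewrite -natrX -natrM ler_nat.
have Np : 0 < N%:R :> R by nra.
have Bp : 0 < B by lra.
have s0 : 0 < s by rewrite invr_gt0 !mulr_gt0.
have sBN : s * (2 * B * N%:R) = 1 by rewrite mulVf // gt_eqF // !mulr_gt0.
have sB : s * B <= 1 by nra.
pose b := Num.sqrt B; have b2 : b ^+ 2 = B by rewrite sqr_sqrtr // ltW.
have b4 : b ^+ 4 = B ^+ 2 by rewrite (exprM b 2 2) b2.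
have sb : s * b ^+ 2 <= 1 by rewrite b2.
have xsb : forall x, x \in xs -> dotp x x <= b ^+ 2 by rewrite b2.
have := deflation_prod_first_order (ltW s0) (sqrtr_ge0 B) sb v1 xsb.
rewrite -/b b4 -/n; set rho' := \sum_(x <- _) _ in rho *.
have rho0 : 0 <= rho' by apply: sumr_ge0 => x _; exact: sqr_ge0.
set z := s * _ => hz.
(* As [2 * s * B * N = 1], the two terms of [N * z] are [rho' / (2 * B)] and [n ^ 2 / (4 * N)]; the
   latter is at most [1 / 40] because [10 * n ^ 2 <= N]. With [1 - z >= expR (- (10 / 9 * z))] and
   the exponent [2 * N], the factor [20 / 9] turns [1 / 6] and [1 / 40] into [10 / 27] and
   [1 / 18]. *)
have zN : N%:R * z <= n%:R / B / 6 + 1 / 40.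
  have -> : N%:R * z = (s * (2 * B * N%:R)) * (rho' / B / 2) +
     (s * (2 * B * N%:R)) ^+ 2 * (n%:R ^+ 2 / (4 * N%:R)).
    by rewrite /z; field; rewrite !gt_eqF.
  rewrite sBN expr1n !mul1r; apply: lerD.
    rewrite [n%:R / B / 6](_ : _ = n%:R / 3 / B / 2); last by field; rewrite gt_eqF.
    by rewrite !ler_pM2r ?invr_gt0.
  rewrite ler_pdivrMr ?mulr_gt0 //; lra.
have z0 : 0 <= z.
  apply: mulr_ge0; first exact: ltW.
  apply: addr_ge0 => //; apply: mulr_ge0; last exact: sqr_ge0.
  by apply: mulr_ge0; [exact: ltW | exact: sqr_ge0].
have z1 : z <= 1 / 10.
  rewrite -(ler_pM2l Np); apply: le_trans zN _.
  have : n%:R / B <= n%:R by rewrite ler_pdivrMr //; nra.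
  nra.
have c0 : 0 <= 1 - z by lra.
have := dotp_mul_le_mxtrace k0 (deflation_symT s xs) v1; rewrite -/N; apply: le_trans.
(* The symmetric product is [M *m M^T], so its form at the unit vector [v] is at least the square of
   [dotp v (M *m v)], which the first-order bound controls. *)
have hq : (1 - z) ^+ 2 <= dotp v (deflation_sym s xs *m v).
  rewrite deflation_symE -mulmxE -mulmxA dotp_mulmx.
  set M := deflation_prod _ _ in hz *.
  apply: (@le_trans _ _ (dotp v (M *m v) ^+ 2)).
    by apply: lerXn2r; rewrite ?nnegrE //; apply: le_trans hz.
  by rewrite dotp_mulmx; apply: le_trans (dotp_sqr_le _ _) _; rewrite v1 mulr1.
apply: (@le_trans _ _ (((1 - z) ^+ 2) ^+ N)); last first.
  by apply: lerXn2r; rewrite ?nnegrE ?sqr_ge0 //; apply: le_trans hq; rewrite sqr_ge0.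
apply: (@le_trans _ _ ((expR (- (10 / 9 * z)) ^+ 2) ^+ N)); last first.
  apply: lerXn2r; rewrite ?nnegrE ?sqr_ge0 //.
  by apply: lerXn2r; rewrite ?nnegrE ?expR_ge0 // expR_le_inv1B.
rewrite -!expRM_natl ler_expR.
set q := n%:R / B in zN *; lra.
Qed.

(** The decay of the potential per sample: with [s = (2 * B * N)^-1] the sum telescopes to
    [(1 - (1 - s * B) ^+ (2 * N)) / B], at least [(1 - 1 / e) / B] since [2 * N * s * B = 1]; this
    is rounded down to [1 / (2 * B)]. *)
Lemma geometric_gain (B : R) N : 1 <= B -> (0 < N)%N ->
  (2 * B)^-1 <= (2 * B * N%:R)^-1 * \sum_(i < 2 * N) (1 - (2 * B * N%:R)^-1 * B) ^+ i.
Proof.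
move=> B1 N0; set s := (2 * B * N%:R)^-1; have Bp : 0 < B by lra.
have Np : 0 < N%:R :> R by rewrite ltr0n.
have s0 : 0 < s by rewrite invr_gt0 !mulr_gt0.
have sBN : s * B * (2 * N)%:R = 1.
  by rewrite natrM /s; field; rewrite !gt_eqF.
rewrite -(ler_pM2l Bp).
set t := 1 - s * B; have := subrX1 t (2 * N); set S := \sum_(i < _) _ => h.
have -> : B * (s * S) = 1 - t ^+ (2 * N).
  by rewrite -[RHS]opprB h /t; ring.
have : t ^+ (2 * N) <= expR (- (s * B)) ^+ (2 * N).
  have t0 : 0 <= t.
    have : 1 <= (2 * N)%:R :> R by rewrite ler1n muln_gt0.
    rewrite /t; have : 0 < s * B by rewrite mulr_gt0.
    by move: sBN; nra.
  apply: lerXn2r; rewrite ?nnegrE ?expR_ge0 //.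
  by have := expR_ge1Dx (- (s * B)).
rewrite -expRM_natr mulNr sBN expRN => h1.
have h2 : (expR 1)^-1 <= 2 / 5 :> R.
  by rewrite -div1r ler_pdivrMr ?expR_gt0 //; have := @expR1_ge52 R; lra.
rewrite (_ : B * (2 * B)^-1 = 1 / 2); last by field; rewrite gt_eqF.
lra.
Qed.

End lower_eigenvalue.

(** * Expectation of products and Chernoff bounds for i.i.d. samples *)

Section integration.
Context {R : realType} {d : measure_display} {T : measurableType d} (P : probability T R).

Lemma bounded_integrable (f : T -> R) (M : R) : measurable_fun setT f ->
  (forall x, `|f x| <= M) -> P.-integrable setT (EFin \o f).
Proof.
move=> mf fM; apply: measurable_bounded_integrable => //.
  by apply: le_lt_trans (probability_le1 P measurableT) _; rewrite ltry.
exists M; split; first exact: num_real.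
by move=> N MN x _ /=; apply: le_trans (fM x) (ltW MN).
Qed.

Lemma ge0_integrable (f : T -> R) (M : R) : measurable_fun setT f ->
  (forall x, 0 <= f x) -> (\int[P]_x (f x)%:E <= M%:E)%E ->
  P.-integrable setT (EFin \o f).
Proof.
move=> mf f0 fM; apply/integrableP; split; first exact/measurable_EFinP.
under eq_integral do rewrite /= ger0_norm //.
by apply: le_lt_trans fM _; rewrite ltry.
Qed.

Lemma EFin_Rintegral (f : T -> R) : P.-integrable setT (EFin \o f) ->
  (\int[P]_x f x)%:E = (\int[P]_x (f x)%:E)%E.
Proof. by move=> fi; rewrite fineK //; exact: integrable_fin_num. Qed.

Lemma markov_ge0 (F : T -> R) (K a : R) : measurable_fun setT F ->
  (forall x, 0 <= F x) -> 0 < a -> (\int[P]_x (F x)%:E <= K%:E)%E ->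
  (P [set x | (a <= F x)%R] <= (K / a)%:E)%E.
Proof.
move=> mF F0 a0 FK.
have mFE : measurable_fun setT (EFin \o F) by exact/measurable_EFinP.
have := @le_integral_comp_abse _ _ _ P setT measurableT (EFin \o F) a id
  (@measurable_id _ _ _) (fun _ => id) (fun _ _ _ _ => id) mFE a0.
under eq_integral do rewrite gee0_abs ?lee_fin //.
rewrite setTI => h; rewrite EFinM muleC -lee_pdivrMl ?invr_gt0 // invrK.
apply: le_trans FK; apply: le_trans h.
rewrite le_eqVlt; apply/orP; left; apply/eqP; congr (_ * P _)%E.
by apply/seteqP; split => x /=; rewrite ger0_norm ?lee_fin.
Qed.

End integration.

Section product_formula.
Context {R : realType} {d d' : measure_display} {T : measurableType d}
  {Omega : measurableType d'} (P : probability T R) (Q : probability Omega R).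

Import HBNNSimple.

(** Passes from indicators to nonnegative functions by simple functions and monotone convergence. In
    its use below, [W] is the product of the factors at the other indices and [c] its mean. *)
Lemma integral_mul_comp (W : Omega -> R) (Y : Omega -> T) (c : R) :
  measurable_fun setT W -> (forall w, 0 <= W w) -> measurable_fun setT Y ->
  0 <= c ->
  (forall A, measurable A -> \int[Q]_w (W w * \1_A (Y w))%:E = c%:E * P A)%E ->
  forall g : T -> R, measurable_fun setT g -> (forall x, 0 <= g x) ->
  (\int[Q]_w (W w * g (Y w))%:E = c%:E * \int[P]_x (g x)%:E)%E.
Proof.
move=> mW W0 mY c0 HA g mg g0.
have simple (f : {nnsfun T >-> R}) :
    (\int[Q]_w (W w * f (Y w))%:E = c%:E * \int[P]_x (f x)%:E)%E.
  rewrite integralT_nnsfun sintegralE ge0_mule_fsumr; last first.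
    by move=> r; exact: nnsfun_mulemu_ge0.
  transitivity (\int[Q]_w (\sum_(r \in range f)
      (W w * (r * \1_(f @^-1` [set r]) (Y w)))%:E))%E.
    apply: eq_integral => w _; rewrite fimfunE fsumEFin //; congr EFin.
    rewrite !fsbig_finite //= mulr_sumr //.
  have mfr r : measurable (f @^-1` [set r]) by [].
  have mI r : measurable_fun setT (fun w => \1_(f @^-1` [set r]) (Y w) : R).
    by apply: measurableT_comp.
  rewrite ge0_integral_fsum //=.
  - apply: eq_fsbigr => r _.
    have [r0|r0] := ltP r 0.
      rewrite preimage_nnfun0 // measure0 !mule0.
      by rewrite integral0_eq // => w _; rewrite indic0 !mulr0.
    transitivity (\int[Q]_w (r%:E * (W w * \1_(f @^-1` [set r]) (Y w))%:E))%E.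
      by apply: eq_integral => w _; rewrite -EFinM mulrCA.
    rewrite ge0_integralZl //.
    + by rewrite HA // muleCA.
    + by apply/measurable_EFinP; exact: measurable_funM.
    + by move=> w _; rewrite lee_fin mulr_ge0.
  - move=> r; apply/measurable_EFinP; apply: measurable_funM => //.
    exact: measurable_funM.
  - move=> r w _; rewrite lee_fin mulr_ge0 //.
    by have := nnfun_muleindic_ge0 f r (Y w); rewrite lee_fin.
have mgE : measurable_fun setT (EFin \o g) by exact/measurable_EFinP.
pose a := nnsfun_approx measurableT mgE.
have acvg x : (EFin \o a^~ x) @ \oo --> (g x)%:E.
  by apply: (@cvg_nnsfun_approx _ _ _ _ measurableT _ mgE) => // y _; rewrite lee_fin.
have and x : {homo (fun n => a n x) : n m / (n <= m)%N >-> n <= m}.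
  by move=> n m nm; exact/lefP/nd_nnsfun_approx.
transitivity (limn (fun n => \int[Q]_w (W w * a n (Y w))%:E))%E.
  rewrite -monotone_convergence //.
  - apply: eq_integral => w _; apply/esym/cvg_lim => //.
    by under eq_fun do rewrite EFinM; rewrite EFinM; apply: cvgeZl => //; exact: acvg.
  - move=> n; apply/measurable_EFinP; apply: measurable_funM => //.
    exact: measurableT_comp.
  - by move=> n w _; rewrite lee_fin mulr_ge0.
  - by move=> w _ n m nm; rewrite lee_fin ler_wpM2l // and.
transitivity (limn (fun n => \int[P]_x (c%:E * (a n x)%:E)))%E.
  apply: congr_lim; apply/funext => n; rewrite simple ge0_integralZl //.
    by apply/measurable_EFinP.
  by move=> x _; rewrite lee_fin.
rewrite -monotone_convergence //.
- transitivity (\int[P]_x (c%:E * (g x)%:E))%E; last first.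
    by rewrite ge0_integralZl // => x _; rewrite lee_fin.
  by apply: eq_integral => x _; apply/cvg_lim => //; apply: cvgeZl => //; exact: acvg.
- by move=> n; apply: measurable_funeM; exact/measurable_EFinP.
- by move=> n x _; rewrite mule_ge0 // lee_fin.
- by move=> x _ n m nm; rewrite lee_wpmul2l // lee_fin and.
Qed.

Section iid.
Variables (n : nat) (X : 'I_n -> Omega -> T).
Hypothesis iidX : iid_sample Q P X.

Let mX i : measurable_fun setT (X i). Proof. by case: iidX. Qed.

Lemma measurable_prod_comp (g : 'I_n -> T -> R) (p : pred 'I_n) :
  (forall i, measurable_fun setT (g i)) ->
  measurable_fun setT (fun w => \prod_(i | p i) g i (X i w)).
Proof.
move=> mg; under eq_fun do rewrite big_mkcond /=.
apply: measurable_prod => i _; case: (p i) => //.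
exact: measurableT_comp.
Qed.

Lemma integral_prod_ge0 (g : 'I_n -> T -> R) :
  (forall i, P.-integrable setT (EFin \o g i)) -> (forall i x, 0 <= g i x) ->
  (\int[Q]_w (\prod_i g i (X i w))%:E = (\prod_i \int[P]_x g i x)%:E)%E.
Proof.
(* Indicators are replaced by arbitrary functions one index at a time. *)
suff H (l : seq 'I_n) (f : 'I_n -> T -> R) :
    (forall i, P.-integrable setT (EFin \o f i)) -> (forall i x, 0 <= f i x) ->
    (forall i, i \notin l -> exists2 A, measurable A & f i = \1_A) ->
    (\int[Q]_w (\prod_i f i (X i w))%:E = (\prod_i \int[P]_x f i x)%:E)%E.
  by move=> gi g0; apply: (H (enum 'I_n)) => // i; rewrite mem_enum.
elim: l f => [|k l IH] f fi f0 fl.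
  (* With no index left to replace, every factor is an indicator, and their product is the indicator
     of the intersection that appears in [iid_sample]. *)
  pose A i := s2val (cid2 (fl i isT)).
  have mA i : measurable (A i) by rewrite /A; case: cid2.
  have fA i : f i = \1_(A i) by rewrite /A; case: cid2.
  have E w : \prod_i f i (X i w) = \1_(\bigcap_(i in [set: 'I_n]) (X i @^-1` A i)) w.
    rewrite [RHS]indicE; case: (boolP (w \in _)) => [/set_mem h|h].
      by apply: big1 => i _; rewrite fA indicE mem_set //; exact: h.
    have [i Ai] : exists i, ~ A i (X i w).
      apply: contrapT => /forallNP hn; move/negP: h; apply; rewrite inE => i _ /=.
      by apply: contrapT; exact: hn.
    by rewrite (bigD1 i) //= fA indicE memNset // mul0r.
  under eq_integral do rewrite E.
  rewrite integral_indic //; last first.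
    apply: fin_bigcap_measurable => // i _.
    by rewrite -[X in measurable X]setTI; exact: mX.
  rewrite setIT; have [_ /(_ A mA) iidE] := iidX.
  apply: etrans iidE _; rewrite -prodEFin; apply: eq_bigr => i _.
  by rewrite EFin_Rintegral // fA integral_indic // setIT.
have mf i : measurable_fun setT (f i).
  by apply/measurable_EFinP; exact: measurable_int (fi i).
pose c := \prod_(i | i != k) \int[P]_x f i x.
have c0 : 0 <= c by apply: prodr_ge0 => i _; exact: Rintegral_ge0.
under eq_integral do rewrite (bigD1 k) //= mulrC.
rewrite (@integral_mul_comp _ _ c) //.
- by rewrite -EFin_Rintegral // -EFinM (bigD1 k) //= mulrC.
- exact: measurable_prod_comp.
- by move=> w; apply: prodr_ge0 => i _.
move=> A mA; pose f' i := if i == k then \1_A else f i.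
have fE i : i != k -> f' i = f i by rewrite /f' => /negbTE ->.
have fk : f' k = \1_A by rewrite /f' eqxx.
have := IH f'; rewrite (bigD1 k) //= fk.
rewrite (eq_bigr (fun i => \int[P]_x f i x)); last by move=> i /fE ->.
rewrite -/c EFinM EFin_Rintegral; last exact: integrable_indic.
rewrite integral_indic // setIT muleC => <-.
- apply: eq_integral => w _; congr EFin.
  rewrite [in RHS](bigD1 k) //= fk mulrC; congr (_ * _).
  by apply: eq_bigr => i /fE ->.
- by move=> i; rewrite /f'; case: eqP => _ //; exact: integrable_indic.
- by move=> i x; rewrite /f'; case: eqP.
- move=> i il; rewrite /f'; case: eqVneq => [_|ik]; first by exists A.
  by apply: fl; rewrite in_cons negb_or ik.
Qed.

Lemma integral_expR_sum_le (Y : T -> R) (K : R) : measurable_fun setT Y ->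
  (\int[P]_x (expR (Y x))%:E <= K%:E)%E ->
  (\int[Q]_w (expR (\sum_i Y (X i w)))%:E <= (K ^+ n)%:E)%E.
Proof.
move=> mY YK; under eq_integral do rewrite expR_sum.
have Yi : P.-integrable setT (EFin \o (expR \o Y)).
  apply: ge0_integrable YK; first exact: measurableT_comp.
  by move=> x; exact: expR_ge0.
rewrite (@integral_prod_ge0 (fun _ x => expR (Y x))) //.
rewrite prodr_const card_ord lee_fin; apply: lerXn2r; rewrite ?nnegrE.
- by apply: Rintegral_ge0 => x _; exact: expR_ge0.
- by rewrite -lee_fin; apply: le_trans YK; apply: integral_ge0 => x _; rewrite lee_fin expR_ge0.
- by rewrite -lee_fin EFin_Rintegral.
Qed.

Lemma chernoff_sum (Y : T -> R) (l c t : R) : measurable_fun setT Y -> 0 <= l ->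
  (\int[P]_x (expR (l * Y x))%:E <= (expR c)%:E)%E ->
  (Q [set w | (t <= \sum_i Y (X i w))%R] <= (expR (n%:R * c - l * t))%:E)%E.
Proof.
move=> mY l0 Yc.
have mlY : measurable_fun setT (fun x => l * Y x) by exact: measurable_funM.
have := integral_expR_sum_le mlY Yc; rewrite -expRM_natl => h.
have mS : measurable_fun setT (fun w => \sum_i (l * Y (X i w))).
  by apply: measurable_sum => i; exact: (measurableT_comp mlY (mX i)).
have := markov_ge0 (measurableT_comp (@measurable_expR R) mS) (fun w => expR_ge0 _)
  (expR_gt0 (l * t)) h.
rewrite -expRB; apply: le_trans.
apply: le_measure; rewrite ?inE.
- rewrite -[X in measurable X]setTI.
  apply: measurable_fun_le => //; apply: measurable_sum => i.
  exact: (measurableT_comp mY (mX i)).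
- rewrite -[X in measurable X]setTI; apply: measurable_fun_le => //.
  exact: (measurableT_comp (@measurable_expR R) mS).
- by move=> w /= tw; rewrite ler_expR -mulr_sumr ler_wpM2l.
Qed.

End iid.

End product_formula.

(** * Expectation of the matrix potential *)

Section integration_sum.
Context {R : realType} {d : measure_display} {T : measurableType d} (P : probability T R).

Lemma Rintegral_cstT (c : R) : \int[P]_x c = c.
Proof.
rewrite Rintegral_cst //.
have PT := @probability_setT _ _ _ P.
by rewrite [X in _ * X](_ : _ = 1) ?mulr1 // [X in fine X](_ : _ = 1%E).
Qed.

Lemma integrable_sumr (I : Type) (s : seq I) (F : I -> T -> R) :
  (forall i, P.-integrable setT (EFin \o F i)) ->
  P.-integrable setT (EFin \o (fun x => \sum_(i <- s) F i x)).
Proof.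
move=> Fi; have -> : EFin \o (fun x => \sum_(i <- s) F i x) =
    (fun x => \sum_(i <- s) (EFin \o F i) x)%E.
  by apply/funext => x /=; rewrite sumEFin.
exact: integrable_sum.
Qed.

Lemma Rintegral_sum (I : Type) (s : seq I) (F : I -> T -> R) :
  (forall i, P.-integrable setT (EFin \o F i)) ->
  \int[P]_x (\sum_(i <- s) F i x) = \sum_(i <- s) \int[P]_x F i x.
Proof.
move=> Fi; elim: s => [|i s IH].
  rewrite big_nil; under eq_Rintegral do rewrite big_nil.
  by rewrite Rintegral_cstT.
rewrite big_cons -IH -RintegralD //; last exact: integrable_sumr.
by apply: eq_Rintegral => x _; rewrite big_cons.
Qed.

End integration_sum.

Section product_span.
Context {R : realType} {d d' : measure_display} {T : measurableType d}
  {Omega : measurableType d'} (P : probability T R) (Q : probability Omega R).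
Variables (n : nat) (X : 'I_n -> Omega -> T).
Hypothesis iidX : iid_sample Q P X.
Implicit Types (l : seq 'I_n) (F G : Omega -> R).

Let mX i : measurable_fun setT (X i). Proof. by case: iidX. Qed.

(* Polynomials in bounded functions of the [X i], [i \in l], form such a span;
   it suffices for the independence of [X i], [i \notin l], from them. *)
Inductive prodspan l : (Omega -> R) -> Prop :=
| prodspan_prod (g : 'I_n -> T -> R) (M : R) :
    (forall i, measurable_fun setT (g i)) -> (forall i x, 0 <= g i x) ->
    (forall i x, g i x <= M) -> (forall i, i \notin l -> g i = cst 1) ->
    prodspan l (fun w => \prod_i g i (X i w))
| prodspan_scale (c : R) F : prodspan l F -> prodspan l (fun w => c * F w)
| prodspan_add F G : prodspan l F -> prodspan l G -> prodspan l (fun w => F w + G w).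

Lemma eq_prodspan l F G : F =1 G -> prodspan l F -> prodspan l G.
Proof. by move=> /funext ->. Qed.

Lemma prodspan_cst l (c : R) : prodspan l (fun=> c).
Proof.
apply: (@eq_prodspan _ (fun w => c * \prod_(i < n) (cst 1 : T -> R) (X i w))).
  by move=> w; rewrite big1 ?mulr1.
apply: prodspan_scale.
by apply: (@prodspan_prod l (fun=> cst 1) 1) => // i; exact: measurable_cst.
Qed.

(** Generators have nonnegative factors, so a signed [q] enters as [(q + M) - M]. *)
Lemma prodspan_coord l i (q : T -> R) (M : R) : i \in l ->
  measurable_fun setT q -> (forall x, `|q x| <= M) ->
  prodspan l (fun w => q (X i w)).
Proof.
move=> il mq qM.
pose g j : T -> R := if j == i then (fun x => q x + M) else cst 1.
apply: (@eq_prodspan _ (fun w => \prod_j g j (X j w) + - M)).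
  move=> w; rewrite (bigD1 i) //= /g eqxx big1 ?mulr1 ?addrK //.
  by move=> j /negbTE ->.
apply: prodspan_add; last exact: prodspan_cst.
have qb x : - M <= q x <= M by rewrite -ler_norml.
apply: (@prodspan_prod l g (`|2 * M| + 1)).
- move=> j; rewrite /g; case: eqP => _ //; exact: measurable_funD.
- by move=> j x; rewrite /g; case: eqP => _ //=; have := qb x; lra.
- move=> j x; rewrite /g; case: eqP => _ /=; last by rewrite lerDr.
  by have := qb x; have := ler_norm (2 * M); lra.
- by move=> j jl; rewrite /g; case: eqP => // ji; rewrite ji il in jl.
Qed.

Lemma prodspan_mul l F G : prodspan l F -> prodspan l G ->
  prodspan l (fun w => F w * G w).
Proof.
move=> lF; elim: lF G => [g M mg g0 gM g1 G lG|c F' _ IH G lG|F1 F2 _ IH1 _ IH2 G lG].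
- elim: lG => [g' M' mg' g'0 g'M g'1|c G' _ IH|G1 G2 _ IH1 _ IH2].
  + apply: (@eq_prodspan _ (fun w => \prod_i (g i (X i w) * g' i (X i w)))).
      by move=> w; rewrite big_split.
    apply: (@prodspan_prod l (fun i x => g i x * g' i x) (M * M')).
    * by move=> i; apply: measurable_funM.
    * by move=> i x; rewrite mulr_ge0.
    * by move=> i x; apply: ler_pM.
    * by move=> i il; rewrite g1 // g'1 //; apply/funext => x /=; rewrite mulr1.
  + by apply: eq_prodspan (prodspan_scale c IH) => w /=; rewrite mulrCA.
  + by apply: eq_prodspan (prodspan_add IH1 IH2) => w /=; rewrite mulrDr.
- by apply: eq_prodspan (prodspan_scale c (IH _ lG)) => w /=; rewrite mulrA.
- by apply: eq_prodspan (prodspan_add (IH1 _ lG) (IH2 _ lG)) => w /=; rewrite mulrDl.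
Qed.

Lemma prodspan_sum l (I : Type) (s : seq I) (F : I -> Omega -> R) :
  (forall i, prodspan l (F i)) -> prodspan l (fun w => \sum_(i <- s) F i w).
Proof.
move=> lF; elim: s => [|i s IH].
  by apply: eq_prodspan (prodspan_cst l 0) => w; rewrite big_nil.
by apply: eq_prodspan (prodspan_add (lF i) IH) => w /=; rewrite big_cons.
Qed.

Lemma prodspan_sub l l' F : {subset l <= l'} -> prodspan l F -> prodspan l' F.
Proof.
move=> ll'; elim=> [g M mg g0 gM g1|c G _ IH|F1 F2 _ IH1 _ IH2].
- by apply: (@prodspan_prod l' g M) => // i il; apply: g1; apply: contra il => /ll'.
- exact: prodspan_scale.
- exact: prodspan_add.
Qed.

Lemma prodspan_bounded l F : prodspan l F ->
  measurable_fun setT F /\ exists M, forall w, `|F w| <= M.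
Proof.
elim=> [g M mg g0 gM g1|c G _ [mG [M GM]]|F1 F2 _ [m1 [M1 H1]] _ [m2 [M2 H2]]].
- split; first exact: (measurable_prod_comp iidX).
  exists (\prod_(i < n) M) => w; rewrite ger0_norm ?prodr_ge0 //.
  by apply: ler_prod => i _; rewrite g0 gM.
- split; first exact: measurable_funM.
  by exists (`|c| * M) => w; rewrite normrM ler_wpM2l.
- split; first exact: measurable_funD.
  by exists (M1 + M2) => w; apply: le_trans (ler_normD _ _) _; exact: lerD.
Qed.

Lemma prodspan_integrable l F : prodspan l F -> Q.-integrable setT (EFin \o F).
Proof. by move=> /prodspan_bounded [mF [M FM]]; exact: bounded_integrable FM. Qed.

Lemma prodspan_indep l F i (q : T -> R) (M : R) : prodspan l F -> i \notin l ->
  measurable_fun setT q -> (forall x, `|q x| <= M) ->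
  \int[Q]_w (F w * q (X i w)) = (\int[Q]_w F w) * (\int[P]_x q x).
Proof.
move=> lF il mq qM.
have lq : prodspan (i :: l) (fun w => q (X i w)).
  by apply: prodspan_coord qM; rewrite ?mem_head.
have sub_l : {subset l <= i :: l} by move=> j jl; rewrite in_cons jl orbT.
elim: lF => [g K mg g0 gK g1|c G lG IH|F1 F2 l1 IH1 l2 IH2].
- have lg : prodspan l (fun w => \prod_j g j (X j w)) by exact: prodspan_prod gK g1.
  have gi j : P.-integrable setT (EFin \o g j).
    by apply: (@bounded_integrable _ _ _ _ _ K) => // x; rewrite ger0_norm.
  have qb x : - M <= q x <= M by rewrite -ler_norml.
  pose g' j : T -> R := if j == i then (fun x => q x + M) else g j.
  have g'i : g' i = (fun x => q x + M) by rewrite /g' eqxx.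
  have g'j j : j != i -> g' j = g j by rewrite /g' => /negbTE ->.
  have qi : P.-integrable setT (EFin \o q) by exact: bounded_integrable qM.
  have Mi : P.-integrable setT (EFin \o cst M).
    by apply: (@bounded_integrable _ _ _ _ _ `|M|) => //; exact: measurable_cst.
  have qMi : P.-integrable setT (EFin \o (fun x => q x + M)).
    have := integrableD measurableT qi Mi.
    by apply: eq_integrable => // x _.
  have E1 : \int[Q]_w (\prod_j g' j (X j w)) = \prod_j \int[P]_x g' j x.
    apply: EFin_inj; rewrite EFin_Rintegral; last first.
      apply: (prodspan_integrable (l := i :: l)); apply: (@prodspan_prod _ _ (K + `|2 * M|)).
      + by move=> j; rewrite /g'; case: eqP => // _; exact: measurable_funD.
      + by move=> j x; rewrite /g'; case: eqP => // _; have := qb x; lra.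
      + move=> j x; have := ler_norm (2 * M); have := normr_ge0 (2 * M).
        have K0 := le_trans (g0 j x) (gK j x).
        by rewrite /g'; case: eqP => // _; [have := qb x | have := gK j x]; lra.
      + by move=> j; rewrite in_cons negb_or => /andP[ji jl]; rewrite g'j // g1.
    apply: (integral_prod_ge0 iidX).
    + by move=> j; rewrite /g'; case: eqP.
    + by move=> j x; rewrite /g'; case: eqP => // _; have := qb x; lra.
  have E2 : \int[Q]_w (\prod_j g j (X j w)) = \prod_j \int[P]_x g j x.
    apply: EFin_inj; rewrite EFin_Rintegral; last exact: prodspan_integrable lg.
    exact: (integral_prod_ge0 iidX).
  rewrite (bigD1 i) //= g'i in E1; rewrite [in RHS](bigD1 i) //= g1 // in E2.
  rewrite (eq_bigr (fun j => \int[P]_x g j x)) in E1; last by move=> j /g'j ->.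
  rewrite RintegralD // Rintegral_cstT in E1.
  rewrite Rintegral_cstT mul1r in E2.
  rewrite -E2 in E1.
  have : \int[Q]_w (\prod_j g' j (X j w)) =
     \int[Q]_w ((\prod_j g j (X j w)) * q (X i w)) + M * \int[Q]_w (\prod_j g j (X j w)).
    rewrite -RintegralZl //; last exact: prodspan_integrable lg.
    rewrite -RintegralD //.
    - apply: eq_Rintegral => w _; rewrite (bigD1 i) //= g'i.
      rewrite [in RHS](bigD1 i) //= g1 //= mul1r (eq_bigr (fun j => g j (X j w))).
        by ring.
      by move=> j /g'j ->.
    - apply: (prodspan_integrable (l := i :: l)).
      by apply: prodspan_mul => //; exact: prodspan_sub lg.
    - by apply: prodspan_integrable (prodspan_scale _ lg).
  rewrite E1; lra.
- rewrite RintegralZl //; last exact: prodspan_integrable lG.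
  rewrite -mulrA -IH -RintegralZl //; last first.
    by apply: (prodspan_integrable (l := i :: l)); apply: prodspan_mul => //; exact: prodspan_sub lG.
  by apply: eq_Rintegral => w _; rewrite mulrA.
- have i1 : Q.-integrable setT (EFin \o (fun w => F1 w * q (X i w))).
    by apply: (prodspan_integrable (l := i :: l)); apply: prodspan_mul => //; exact: prodspan_sub l1.
  have i2 : Q.-integrable setT (EFin \o (fun w => F2 w * q (X i w))).
    by apply: (prodspan_integrable (l := i :: l)); apply: prodspan_mul => //; exact: prodspan_sub l2.
  rewrite RintegralD //; try exact: prodspan_integrable l1; try exact: prodspan_integrable l2.
  rewrite mulrDl -IH1 -IH2 -RintegralD //.
  by apply: eq_Rintegral => w _; rewrite mulrDl.
Qed.

Section matrix_span.
Variable m : nat.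
Implicit Types A C : Omega -> 'M[R]_m.

Definition prodspan_mx l A := forall a b, prodspan l (fun w => A w a b).

Lemma prodspan_mx1 l : prodspan_mx l (fun=> 1).
Proof.
by move=> a b; apply: eq_prodspan (prodspan_cst l (a == b)%:R) => w; rewrite mxE.
Qed.

Lemma prodspan_mx_mul l A C : prodspan_mx l A -> prodspan_mx l C ->
  prodspan_mx l (fun w => A w * C w).
Proof.
move=> lA lC a b; apply: (@eq_prodspan _ (fun w => \sum_j A w a j * C w j b)).
  by move=> w; rewrite mxE.
by apply: prodspan_sum => j; exact: prodspan_mul.
Qed.

Lemma prodspan_mxX l A k : prodspan_mx l A -> prodspan_mx l (fun w => A w ^+ k).
Proof.
move=> lA; elim: k => [|k IH]; first exact: prodspan_mx1.
move=> a b; apply: eq_prodspan (prodspan_mx_mul lA IH a b) => w.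
by rewrite exprS.
Qed.

Lemma prodspan_mxtrace l A : prodspan_mx l A -> prodspan l (fun w => \tr (A w)).
Proof. by move=> lA; apply: prodspan_sum => a. Qed.

End matrix_span.

Section potential.
Variables (m : nat) (x : T -> 'cV[R]_m) (M : R).
Hypotheses (mx : forall j, measurable_fun setT (fun t => x t j ord0))
  (xM : forall j t, `|x t j ord0| <= M)
  (xI : forall a b, \int[P]_t (x t a ord0 * x t b ord0) = (a == b)%:R).

Let xs l w := [seq x (X i w) | i <- l].

Lemma prodspan_deflation l i s : i \in l -> prodspan_mx l (fun w => deflation s (x (X i w))).
Proof.
move=> il a b.
apply: (@eq_prodspan _ (fun w => (a == b)%:R +
    (- s) * (x (X i w) a ord0 * x (X i w) b ord0))).
  by move=> w; rewrite !mxE big_ord1 !mxE mulNr.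
apply: prodspan_add; first exact: prodspan_cst.
by apply: prodspan_scale; apply: prodspan_mul;
  apply: (prodspan_coord (q := fun t => x t _ ord0)).
Qed.

Lemma prodspan_deflation_sym l s : prodspan_mx l (fun w => deflation_sym s (xs l w)).
Proof.
suff H l' : {subset l' <= l} -> prodspan_mx l (fun w => deflation_sym s (xs l' w)) by exact: H.
elim: l' => [_|i l' IH il]; first exact: prodspan_mx1.
have lk : prodspan_mx l (fun w => deflation s (x (X i w))).
  by apply: prodspan_deflation; apply: il; rewrite mem_head.
apply: prodspan_mx_mul => //; apply: prodspan_mx_mul => //.
by apply: IH => j jl; apply: il; rewrite in_cons jl orbT.
Qed.

Lemma prodspan_potential l s N : prodspan l (fun w => \tr (deflation_sym s (xs l w) ^+ N)).
Proof. by apply: prodspan_mxtrace; apply: prodspan_mxX; exact: prodspan_deflation_sym. Qed.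

Lemma mxtrace_deflation_sym_ge0 s (ys : seq 'cV[R]_m) k : (0 < k)%N ->
  0 <= \tr (deflation_sym s ys ^+ (2 ^ k)).
Proof.
case: k => // k _; rewrite expnS mulnC exprM expr2.
by rewrite -{2}(deflation_symT s ys) -trmxX mxtrace_mul_tr_ge0.
Qed.

(** The term subtracted in [mxtrace_deflation_step] is linear in [x *m x^T], with coefficients
    depending on [l] only. Independence and [xI] replace [x *m x^T] by the identity in the mean,
    which turns it into a multiple of the potential itself and closes the recursion. *)
Lemma integral_potential_step i l s (b : R) k : (0 < k)%N -> 0 <= s -> s * b <= 1 ->
  (forall t, dotp (x t) (x t) <= b) -> i \notin l ->
  \int[Q]_w \tr (deflation_sym s (xs (i :: l) w) ^+ (2 ^ k)) <=
  (1 - s * \sum_(j < 2 * 2 ^ k) (1 - s * b) ^+ j) *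
    \int[Q]_w \tr (deflation_sym s (xs l w) ^+ (2 ^ k)).
Proof.
move=> k0 s0 sb xb il; set c := s * _; set N := (2 ^ k)%N.
pose A w := deflation_sym s (xs l w) ^+ N.
have lA : prodspan_mx l A by apply: prodspan_mxX; exact: prodspan_deflation_sym.
have xxM a c' t : `|x t a ord0 * x t c' ord0| <= M * M.
  by rewrite normrM; apply: ler_pM.
have mxx a c' : measurable_fun setT (fun t => x t a ord0 * x t c' ord0).
  exact: measurable_funM.
pose q w := \sum_a \sum_c' A w a c' * (x (X i w) a ord0 * x (X i w) c' ord0).
have sub_l : {subset l <= i :: l} by move=> j jl; rewrite in_cons jl orbT.
have lAx a c' : prodspan (i :: l)
    (fun w => A w a c' * (x (X i w) a ord0 * x (X i w) c' ord0)).
  apply: prodspan_mul; first exact: prodspan_sub (lA a c').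
  by apply: prodspan_coord (mxx a c') (xxM a c'); rewrite mem_head.
have lq : prodspan (i :: l) q.
  by apply: prodspan_sum => a; apply: prodspan_sum => c'.
have Eq : \int[Q]_w q w = \int[Q]_w \tr (A w).
  rewrite Rintegral_sum; last first.
    by move=> a; apply: (prodspan_integrable (l := i :: l)); exact: prodspan_sum.
  rewrite [RHS]Rintegral_sum; last by move=> a; exact: prodspan_integrable (lA a a).
  apply: eq_bigr => a _; rewrite Rintegral_sum; last first.
    by move=> c'; exact: prodspan_integrable (lAx a c').
  rewrite (bigD1 a) //= big1 ?addr0.
    by rewrite (prodspan_indep (lA a a) il (mxx a a) (xxM a a)) xI eqxx mulr1.
  move=> c' ca.
  by rewrite (prodspan_indep (lA a c') il (mxx a c') (xxM a c')) xI eq_sym (negbTE ca) mulr0.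
have lt := prodspan_mxtrace lA.
apply: (@le_trans _ _ (\int[Q]_w (\tr (A w) - c * q w))).
  apply: le_Rintegral => //.
  - exact: prodspan_integrable (prodspan_potential (i :: l) s N).
  - apply: (prodspan_integrable (l := i :: l)).
    apply: (@eq_prodspan _ (fun w => \tr (A w) + (- c) * q w)).
      by move=> w; rewrite mulNr.
    by apply: prodspan_add; [exact: prodspan_sub lt | exact: prodspan_scale].
  - move=> w _ /=.
    apply: le_trans (mxtrace_deflation_step k0 s0 sb (xb _) (deflation_symT _ _)) _.
    rewrite -/c lerD2l lerN2 le_eqVlt; apply/orP; left; apply/eqP; congr (_ * _).
    rewrite mxtrace_outer /q /dotp; apply: eq_bigr => a _.
    by rewrite mxE mulr_sumr; apply: eq_bigr => c' _; rewrite -/N -/(A w); ring.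
rewrite RintegralB //; last 2 first.
- exact: prodspan_integrable lt.
- exact: prodspan_integrable (prodspan_scale c lq).
rewrite RintegralZl //; last exact: prodspan_integrable lq.
by rewrite Eq mulrBl mul1r.
Qed.

(** The factor [m] is the trace of the identity, the potential of the empty sample. *)
Lemma integral_potential_le l (B : R) k : (0 < k)%N -> 1 <= B ->
  (forall t, dotp (x t) (x t) <= B) -> uniq l ->
  \int[Q]_w \tr (deflation_sym (2 * B * (2 ^ k)%:R)^-1 (xs l w) ^+ (2 ^ k)) <=
  m%:R * expR (- (2 * B)^-1) ^+ size l.
Proof.
move=> k0 B1 xB; set s := (_ * _)^-1.
have N0 : 1 <= (2 ^ k)%:R :> R by rewrite ler1n expn_gt0.
have s0 : 0 <= s by rewrite invr_ge0 !mulr_ge0 //; lra.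
have sB : s * B <= 1.
  rewrite mulrC ler_pdivrMr; last by rewrite !mulr_gt0 //; lra.
  nra.
elim: l => [_|i l IH /= /andP[il ul]].
  rewrite /= expr0 mulr1; under eq_Rintegral do rewrite /= expr1n mxtrace1.
  by rewrite Rintegral_cstT.
apply: le_trans (integral_potential_step k0 s0 sB xB il) _.
rewrite exprS mulrCA.
apply: (@le_trans _ _ (expR (- (2 * B)^-1) * \int[Q]_w \tr (deflation_sym s (xs l w) ^+ (2 ^ k)))).
  apply: ler_wpM2r; first by apply: Rintegral_ge0 => w _; exact: mxtrace_deflation_sym_ge0.
  apply: le_trans (expR_ge1Dx _); rewrite lerD2l lerN2.
  by apply: geometric_gain => //; rewrite expn_gt0.
by apply: ler_wpM2l; [exact: expR_ge0 | exact: IH].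
Qed.

End potential.

End product_span.

(** * Tails of the sample mean and of the sample second moment *)

Section hyperbolic_product.
Context {R : realType}.

(** If some coordinate exceeds [r], its factor alone is at least [expR r / 2], hence at least
    [expR (r - 1)]. Otherwise the chord bound holds for each factor, and the exponents add up to at
    least [r - 1]. *)
Lemma prod_cosh_ge (m : nat) (z : 'I_m -> R) (r : R) : 11 / 3 <= r ->
  r ^+ 2 <= \sum_j z j ^+ 2 ->
  expR (r - 1) <= \prod_j ((expR (z j) + expR (- z j)) / 2).
Proof.
move=> r3 rz; have r0 : 0 < r by lra.
have c1 j : 1 <= (expR (z j) + expR (- z j)) / 2.
  by apply: le_trans (cosh_ge _); rewrite lerDl divr_ge0 ?sqr_ge0.
have [/existsP[j rj]|] := boolP [exists j, r < `|z j|].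
  rewrite (bigD1 j) //= -[leLHS]mulr1; apply: ler_pM; rewrite ?expR_ge0 //; last first.
    apply: (big_ind (fun y => 1 <= y)) => // a b a1 b1.
    by rewrite -[1]mulr1; apply: ler_pM.
  have h : expR `|z j| <= expR (z j) + expR (- z j).
    have := expR_ge0 (z j); have := expR_ge0 (- z j).
    by case: ler0P => _; lra.
  have h2 : expR r <= expR `|z j| by rewrite ler_expR ltW.
  rewrite expRB ler_pdivrMr ?expR_gt0 //.
  have := @expR1_ge52 R; have := expR_gt0 r; nra.
rewrite negb_exists => /forallP zr.
apply: (@le_trans _ _ (\prod_j expR (z j ^+ 2 * ((r - 1) / r ^+ 2)))).
  rewrite -expR_sum ler_expR -mulr_suml mulrCA.
  rewrite ler_pMr ?subr_gt0; last lra.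
  by rewrite ler_pdivlMr ?mul1r // exprn_gt0.
apply: ler_prod => j _; rewrite expR_ge0 /=.
by apply: cosh_ge_expR_chord => //; rewrite leNgt.
Qed.

Definition sgnb (b : bool) : R := if b then 1 else -1.

Lemma sum_expR_signs (m : nat) (z : 'I_m -> R) :
  \sum_(u : {ffun 'I_m -> bool}) expR (\sum_j sgnb (u j) * z j) =
  2 ^+ m * \prod_j ((expR (z j) + expR (- z j)) / 2).
Proof.
transitivity (\sum_(u : {ffun 'I_m -> bool}) \prod_j expR (sgnb (u j) * z j)).
  by apply: eq_bigr => u _; rewrite expR_sum.
rewrite -(bigA_distr_bigA (fun j b => expR (sgnb b * z j))).
rewrite big_split /= prodr_const card_ord mulrCA -exprMn divff // expr1n mulr1.
by apply: eq_bigr => j _; rewrite big_bool /= mul1r mulN1r.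
Qed.

End hyperbolic_product.

Section tails.
Context {R : realType} {d d' : measure_display} {T : measurableType d}
  {Omega : measurableType d'} (P : probability T R) (Q : probability Omega R).

Lemma measure_bigsetU_le (I : Type) (s : seq I) (A : I -> set Omega) :
  (forall i, measurable (A i)) ->
  measurable (\big[setU/set0]_(i <- s) A i) /\
  (Q (\big[setU/set0]_(i <- s) A i) <= \sum_(i <- s) Q (A i))%E.
Proof.
move=> mA; elim: s => [|i s [mS IH]].
  by rewrite !big_nil measure0; split.
rewrite !big_cons; split; first exact: measurableU.
by apply: le_trans (measureU2 _ _ _) _ => //; exact: leeD2l.
Qed.

(** Shared by the bounded case, where [W] is [Y ^+ 2], and the noisy case, where [W] carries an
    exponential weight. *)
Lemma mgf_le (Y W : T -> R) (l : R) :
  P.-integrable setT (EFin \o Y) -> P.-integrable setT (EFin \o W) ->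
  \int[P]_x Y x = 0 ->
  (forall x, expR (l * Y x) <= 1 + l * Y x + l ^+ 2 * W x) ->
  (\int[P]_x (expR (l * Y x))%:E <= (expR (l ^+ 2 * \int[P]_x W x))%:E)%E.
Proof.
move=> Yi Wi Y0 H.
have mY : measurable_fun setT Y by apply/measurable_EFinP; exact: measurable_int Yi.
have mW : measurable_fun setT W by apply/measurable_EFinP; exact: measurable_int Wi.
have ci : P.-integrable setT (EFin \o cst (1 : R)).
  by apply: (@bounded_integrable _ _ _ _ _ `|1|) => //; exact: measurable_cst.
have lYi : P.-integrable setT (EFin \o (fun x => l * Y x)).
  by have := integrableZl measurableT l Yi; apply: eq_integrable.
have lWi : P.-integrable setT (EFin \o (fun x => l ^+ 2 * W x)).
  by have := integrableZl measurableT (l ^+ 2) Wi; apply: eq_integrable.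
have c1i : P.-integrable setT (EFin \o (fun x => 1 + l * Y x)).
  by have := integrableD measurableT ci lYi; apply: eq_integrable.
have c2i : P.-integrable setT (EFin \o (fun x => 1 + l * Y x + l ^+ 2 * W x)).
  by have := integrableD measurableT c1i lWi; apply: eq_integrable.
apply: (@le_trans _ _ (\int[P]_x (1 + l * Y x + l ^+ 2 * W x)%:E)%E).
  apply: ge0_le_integral => //.
  - apply/measurable_EFinP; apply: measurableT_comp => //; exact: measurable_funM.
  - exact: measurable_int c2i.
  - by move=> x _; rewrite lee_fin.
rewrite -EFin_Rintegral // lee_fin RintegralD // RintegralD // !RintegralZl // Y0.
by rewrite Rintegral_cstT mulr0 addr0; exact: expR_ge1Dx.
Qed.

Variables (n : nat) (X : 'I_n -> Omega -> T).
Hypothesis iidX : iid_sample Q P X.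

Let mX i : measurable_fun setT (X i). Proof. by case: iidX. Qed.

Lemma measurable_sum_comp (Y : T -> R) : measurable_fun setT Y ->
  measurable_fun setT (fun w => \sum_i Y (X i w)).
Proof. by move=> mY; apply: measurable_sum => i; exact: measurableT_comp. Qed.

Lemma measurable_ge (F : Omega -> R) (t : R) : measurable_fun setT F ->
  measurable [set w | t <= F w].
Proof. by move=> mF; rewrite -[X in measurable X]setTI; apply: measurable_fun_le. Qed.

Lemma chernoff_abs_sum (Y : T -> R) (l c t : R) : measurable_fun setT Y -> 0 <= l ->
  (\int[P]_x (expR (l * Y x))%:E <= (expR c)%:E)%E ->
  (\int[P]_x (expR (- l * Y x))%:E <= (expR c)%:E)%E ->
  measurable [set w | t <= `|\sum_i Y (X i w)|] /\
  (Q [set w | (t <= `|\sum_i Y (X i w)|)%R] <= (2 * expR (n%:R * c - l * t))%:E)%E.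
Proof.
move=> mY l0 Y1 Y2.
have mS := measurable_sum_comp mY.
have mNY : measurable_fun setT (fun x => - Y x) by exact: measurableT_comp.
have mNS := measurable_sum_comp mNY.
have mbad : measurable [set w | t <= `|\sum_i Y (X i w)|].
  by apply: measurable_ge; exact: measurableT_comp.
split=> //.
have Y2' : (\int[P]_x (expR (l * - Y x))%:E <= (expR c)%:E)%E.
  by under eq_integral do rewrite mulrN -mulNr.
have h1 := chernoff_sum iidX t mY l0 Y1.
have h2 := chernoff_sum iidX t mNY l0 Y2'.
have mA : measurable [set w | t <= \sum_i Y (X i w)] by exact: measurable_ge.
have mB : measurable [set w | t <= \sum_i - Y (X i w)] by exact: measurable_ge.
rewrite mulrDl mul1r EFinD; apply: le_trans (leeD h1 h2).
apply: le_trans (measureU2 _ mA mB); apply: le_measure; rewrite ?inE //.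
  exact: measurableU.
move=> w /=; rewrite sumrN ler_normr => /orP[]; by [left | right].
Qed.

Section isotropic.
Variables (m : nat) (x : T -> 'cV[R]_m) (M B : R).
Hypotheses (n0 : (0 < n)%N) (m0 : (0 < m)%N)
  (mx : forall j, measurable_fun setT (fun t => x t j ord0))
  (xM : forall j t, `|x t j ord0| <= M)
  (xI : forall a b, \int[P]_t (x t a ord0 * x t b ord0) = (a == b)%:R)
  (xB : forall t, dotp (x t) (x t) <= B).

(** A single failing direction already pushes the potential up to [thr], so Markov's inequality for
    one random variable covers all [v] at once, without a net on the sphere. *)
Lemma gram_tail : 1 <= B ->
  exists2 bad : set Omega, measurable bad /\
    (Q bad <= (m%:R * expR (- (7 / 54 * (n%:R / B)) + 1 / 18))%:E)%E &
    forall w, ~ bad w -> forall v : 'cV[R]_m,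
      n%:R / 3 * dotp v v <= \sum_i dotp (x (X i w)) v ^+ 2.
Proof.
move=> B1.
(* The only demand is [10 * n ^ 2 <= 2 ^ k]; as [k < 2 ^ k], this crude exponent will do. *)
pose k := (10 * n ^ 2)%N; have k0 : (0 < k)%N by rewrite muln_gt0 /= expn_gt0 n0.
have kN : (10 * n ^ 2 <= 2 ^ k)%N by exact: ltnW (ltn_expl _ _).
pose xs w := [seq x (X i w) | i <- enum 'I_n].
have sxs w : size (xs w) = n by rewrite size_map size_enum_ord.
pose s : R := (2 * B * (2 ^ k)%:R)^-1.
pose F w := \tr (deflation_sym s (xs w) ^+ (2 ^ k)).
have lF : prodspan X (enum 'I_n) F.
  exact: (prodspan_potential X mx xM (enum 'I_n) s (2 ^ k)).
have [mF _] := prodspan_bounded iidX lF.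
have F0 w : 0 <= F w by exact: mxtrace_deflation_sym_ge0.
have FE : (\int[Q]_w (F w)%:E <= (m%:R * expR (- (2 * B)^-1) ^+ n)%:E)%E.
  rewrite -EFin_Rintegral; last exact: (prodspan_integrable iidX lF).
  rewrite lee_fin -[X in _ ^+ X](size_enum_ord n).
  by apply: (integral_potential_le iidX mx xM xI) => //; exact: enum_uniq.
(* The lower bound of [mxtrace_deflation_sym_ge]; against the mean [m * expR (- n / (2 * B))],
   Markov's inequality leaves [1 / 2 - 10 / 27 = 7 / 54]. *)
pose thr : R := expR (- (10 / 27 * (n%:R / B) + 1 / 18)).
exists [set w | thr <= F w].
  split; first exact: measurable_ge.
  apply: le_trans (markov_ge0 mF F0 (expR_gt0 _) FE) _.
  rewrite lee_fin -mulrA ler_wpM2l // -expRM_natl -expRB ler_expR.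
  rewrite (_ : (2 * B)^-1 = B^-1 / 2); last by rewrite invfM mulrC.
  by set b := B^-1; lra.
move=> w /= /negP; rewrite -ltNge => Fw v.
rewrite leNgt; apply/negP => vlt.
have v0 : 0 < dotp v v.
  rewrite lt_def dotp_ge0 andbT; apply/eqP => v0; move: vlt.
  by rewrite v0 mulr0 ltNge sumr_ge0 // => i _; exact: sqr_ge0.
pose c := (Num.sqrt (dotp v v))^-1.
have c2 : c ^+ 2 = (dotp v v)^-1 by rewrite exprVn sqr_sqrtr // ltW.
have cv : dotp (c *: v) (c *: v) = 1.
  by rewrite dotpZl dotpZr mulrA -expr2 c2 mulVf // gt_eqF.
move: Fw; rewrite ltNge => /negP; apply.
have := @mxtrace_deflation_sym_ge R m B (xs w) (c *: v) k; rewrite /= sxs; apply => //.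
- by move=> y /mapP[i _ ->].
- rewrite big_map big_enum /=.
  under eq_bigr do rewrite dotpZr exprMn c2.
  rewrite -mulr_sumr mulrC ler_pdivrMr //; exact: ltW.
Qed.

(** Markov's inequality is applied once to the sum over all sign vectors, so [2 ^+ m] cancels
    against the same factor in the threshold and the probability bears no factor depending on
    [m]. *)
Lemma mean_tail (l : R) : (forall j, \int[P]_t x t j ord0 = 0) ->
  4 / 3 <= l -> 18 * B * l <= n%:R ->
  exists2 bad : set Omega, measurable bad /\ (Q bad <= (expR (- l))%:E)%E &
    forall w, ~ bad w ->
      \sum_j (\sum_i x (X i w) j ord0) ^+ 2 <= (11 / 4) ^+ 2 * m%:R * l * n%:R.
Proof.
move=> x0 l4 nB.
have np : 0 < n%:R :> R by rewrite ltr0n.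
have mp : 0 < m%:R :> R by rewrite ltr0n.
have l0 : 0 < l by lra.
(* This makes [n * s ^+ 2 * m], the bound on the logarithm of the total exponential moment for a
   fixed sign vector, equal to [l]. *)
pose s := Num.sqrt (l / (n%:R * m%:R)).
have s2 : s ^+ 2 = l / (n%:R * m%:R).
  by rewrite sqr_sqrtr // divr_ge0 ?mulr_ge0 // ltW.
pose Y (u : {ffun 'I_m -> bool}) t := \sum_j sgnb (u j) * x t j ord0 : R.
have mY u : measurable_fun setT (Y u).
  by apply: measurable_sum => j; exact: measurable_funM.
have sg1 b : sgnb b ^+ 2 = 1 :> R by case: b; rewrite /sgnb ?sqrrN expr1n.
have YB u t : Y u t ^+ 2 <= m%:R * B.
  apply: le_trans (sum_mul_sqr_le _ _) _.
  under eq_bigr do rewrite sg1.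
  rewrite sumr_const card_ord; apply: ler_wpM2l => //.
  by apply: le_trans (xB t); apply: ler_sum => j _; rewrite expr2.
have xi j : P.-integrable setT (EFin \o (fun t => x t j ord0)).
  exact: bounded_integrable (xM j).
have mxx a c : measurable_fun setT (fun t => x t a ord0 * x t c ord0).
  exact: measurable_funM.
have xxi a c : P.-integrable setT (EFin \o (fun t => x t a ord0 * x t c ord0)).
  apply: (@bounded_integrable _ _ _ _ _ (M * M)) => // t.
  by rewrite normrM; apply: ler_pM.
have sxi u j : P.-integrable setT (EFin \o (fun t => sgnb (u j) * x t j ord0)).
  by have := integrableZl measurableT (sgnb (u j)) (xi j); apply: eq_integrable.
have Yi u : P.-integrable setT (EFin \o Y u).
  exact: integrable_sumr.
have Y0 (u : {ffun 'I_m -> bool}) : \int[P]_t Y u t = 0.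
  rewrite Rintegral_sum //; apply: big1 => j _.
  by rewrite RintegralZl // x0 mulr0.
have Y2E u : (fun t => Y u t ^+ 2) = (fun t => \sum_a \sum_c
    (sgnb (u a) * sgnb (u c)) * (x t a ord0 * x t c ord0)).
  apply/funext => t; rewrite expr2 mulr_suml; apply: eq_bigr => a _.
  by rewrite mulr_sumr; apply: eq_bigr => c _; ring.
have ssi u a c : P.-integrable setT
    (EFin \o (fun t => (sgnb (u a) * sgnb (u c)) * (x t a ord0 * x t c ord0))).
  by have := integrableZl measurableT (sgnb (u a) * sgnb (u c)) (xxi a c); apply: eq_integrable.
have Y2i u : P.-integrable setT (EFin \o (fun t => Y u t ^+ 2)).
  by rewrite Y2E; apply: integrable_sumr => a; exact: integrable_sumr.
have Y2 (u : {ffun 'I_m -> bool}) : \int[P]_t (Y u t ^+ 2) = m%:R.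
  rewrite Y2E Rintegral_sum; last by move=> a; exact: integrable_sumr.
  rewrite (eq_bigr (fun=> 1)) ?sumr_const ?card_ord // => a _.
  rewrite Rintegral_sum // (bigD1 a) //= big1 ?addr0.
    by rewrite RintegralZl // xI eqxx mulr1 -expr2 sg1.
  by move=> c ca; rewrite RintegralZl // xI eq_sym (negbTE ca) mulr0.
have mgfY (u : {ffun 'I_m -> bool}) :
    (\int[P]_t (expR (s * Y u t))%:E <= (expR (s ^+ 2 * m%:R))%:E)%E.
  rewrite -(Y2 u); apply: mgf_le => // t.
  rewrite -exprMn; apply: expR_le_quad.
  apply: le_trans (ler_norm _) _; rewrite -ler_sqr ?nnegrE //.
  rewrite real_normK ?num_real // exprMn s2.
  apply: (@le_trans _ _ (l / (n%:R * m%:R) * (m%:R * B))).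
    by apply: ler_wpM2l => //; rewrite divr_ge0 ?mulr_ge0 // ltW.
  rewrite (_ : l / _ * _ = l * B / n%:R); last by field; rewrite !gt_eqF.
  rewrite ler_pdivrMr //; nra.
pose F w := \sum_(u : {ffun 'I_m -> bool}) expR (\sum_i s * Y u (X i w)).
have msY u : measurable_fun setT (fun t => s * Y u t) by exact: measurable_funM.
have mE u : measurable_fun setT (fun w => expR (\sum_i s * Y u (X i w))).
  by apply: measurableT_comp => //; exact: (measurable_sum_comp (msY u)).
have mF : measurable_fun setT F by exact: measurable_sum.
have F0 w : 0 <= F w by apply: sumr_ge0 => u _; exact: expR_ge0.
have FE : (\int[Q]_w (F w)%:E <= (2 ^+ m * expR (s ^+ 2 * m%:R) ^+ n)%:E)%E.
  under eq_integral do rewrite -sumEFin.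
  rewrite ge0_integral_sum //; last first.
    by move=> u; apply/measurable_EFinP; exact: mE.
  apply: (@le_trans _ _ (\sum_(u : {ffun 'I_m -> bool}) (expR (s ^+ 2 * m%:R) ^+ n)%:E)%E).
    by apply: lee_sum => u _; exact: (integral_expR_sum_le iidX (msY u) (mgfY u)).
  rewrite sumEFin lee_fin sumr_const card_ffun card_bool card_ord.
  by rewrite -natrX mulr_natl.
have s2m : s ^+ 2 * m%:R = l / n%:R by rewrite s2; field; rewrite !gt_eqF.
(* Markov's exponent is [l - (r - 1) = 1 - 7 / 4 * l], at most [- l] exactly when [l >= 4 / 3]. *)
pose r := 11 / 4 * l.
pose thr := 2 ^+ m * expR (r - 1).
have thr0 : 0 < thr by rewrite mulr_gt0 ?expR_gt0 ?exprn_gt0.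
exists [set w | thr <= F w].
  split; first exact: measurable_ge.
  apply: le_trans (markov_ge0 mF F0 thr0 FE) _.
  rewrite lee_fin /thr -mulf_div divff ?expf_neq0 // mul1r s2m -expRM_natl -expRB ler_expR.
  rewrite mulrCA divff ?gt_eqF // mulr1 /r; lra.
move=> w /= /negP; rewrite -ltNge => Fw; rewrite leNgt; apply/negP => h.
move: Fw; rewrite ltNge => /negP; apply.
rewrite /F.
have -> : \sum_(u : {ffun 'I_m -> bool}) expR (\sum_i s * Y u (X i w)) =
    \sum_(u : {ffun 'I_m -> bool}) expR (\sum_j sgnb (u j) * (s * \sum_i x (X i w) j ord0)).
  apply: eq_bigr => u _; congr expR; rewrite -mulr_sumr exchange_big /= mulr_sumr.
  apply: eq_bigr => j _; rewrite !mulr_sumr.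
  by apply: eq_bigr => i _; rewrite mulrCA.
rewrite sum_expR_signs ler_pM2l ?exprn_gt0 //.
apply: prod_cosh_ge; first by rewrite /r; lra.
under eq_bigr do rewrite exprMn s2.
rewrite -mulr_sumr mulrC -ler_pdivrMr ?divr_gt0 ?mulr_gt0 //.
apply: le_trans _ (ltW h); rewrite le_eqVlt; apply/orP; left; apply/eqP.
by rewrite /r; field; rewrite !gt_eqF.
Qed.

End isotropic.

End tails.

(** * Tails involving sub-Gaussian noise *)

Section subgaussian.
Context {R : realType} {d : measure_display} {T : measurableType d} (P : probability T R).
Variables (eps : T -> R) (tau : R).
Hypotheses (tau0 : 0 < tau) (meps : measurable_fun setT eps)
  (sg : subgaussian_fun P eps (tau ^+ 2)).

Lemma subgaussian_mgf_integrable (l : R) :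
  P.-integrable setT (EFin \o (fun x => expR (l * eps x))).
Proof.
apply: ge0_integrable (sg l); last by move=> x; exact: expR_ge0.
by apply: measurableT_comp => //; exact: measurable_funM.
Qed.

Lemma subgaussian_integrable : P.-integrable setT (EFin \o eps).
Proof.
have e2 : P.-integrable setT (EFin \o (fun x => expR (1 * eps x) + expR (- 1 * eps x))).
  have := integrableD measurableT (subgaussian_mgf_integrable 1)
    (subgaussian_mgf_integrable (- 1)).
  by apply: eq_integrable.
apply: le_integrable e2 => //; first exact/measurable_EFinP.
move=> x _ /=; rewrite lee_fin [leRHS]ger0_norm ?addr_ge0 ?expR_ge0 // mul1r mulN1r.
have := expR_ge1Dx (eps x); have := expR_ge1Dx (- eps x).
have := expR_ge0 (eps x); have := expR_ge0 (- eps x).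
by case: ler0P => _; lra.
Qed.

(** The constant [3 / 10] matches the bound [3 / 10 / tau] on [l j * x t j ord0] in [cross_tail], so
    that the weight dominates the exponential remainder there. *)
Definition weighted_sqr x : R := eps x ^+ 2 * expR (3 / 10 * `|eps x / tau|).

Lemma weighted_sqr_ge0 x : 0 <= weighted_sqr x.
Proof. by rewrite mulr_ge0 ?sqr_ge0 ?expR_ge0. Qed.

Lemma measurable_weighted_sqr : measurable_fun setT weighted_sqr.
Proof.
apply: measurable_funM; first exact: measurable_funX.
apply: measurableT_comp => //; apply: measurable_funM => //.
by apply: measurableT_comp => //; exact: measurable_funM.
Qed.

Lemma weighted_sqr_bound :
  P.-integrable setT (EFin \o weighted_sqr) /\
  \int[P]_x weighted_sqr x <= 3 * tau ^+ 2.
Proof.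
pose a := 3 / 2 / tau; pose c := tau ^+ 2 * (25 / 9 * expR (-2)).
have c0 : 0 <= c by rewrite mulr_ge0 ?sqr_ge0 // mulr_ge0 ?expR_ge0.
have ptw x : weighted_sqr x <= c * (expR (a * eps x) + expR (- a * eps x)).
  rewrite /weighted_sqr /c; set y := eps x / tau.
  have ey : eps x = tau * y by rewrite /y; field; rewrite gt_eqF.
  have -> : a * eps x = 3 / 2 * y by rewrite /a /y; ring.
  have -> : - a * eps x = - (3 / 2 * y) by rewrite /a /y; ring.
  set E := expR (3 / 10 * _); set F := _ + _.
  have -> : eps x ^+ 2 * E = tau ^+ 2 * (y ^+ 2 * E) by rewrite ey; ring.
  have -> : tau ^+ 2 * (25 / 9 * expR (-2)) * F = tau ^+ 2 * (25 / 9 * expR (-2) * F) by ring.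
  rewrite ler_wpM2l ?sqr_ge0 //.
  apply: le_trans (sqr_mul_expR_le y) _; rewrite ler_wpM2l ?mulr_ge0 ?expR_ge0 // /F.
  have := expR_ge0 (3 / 2 * y); have := expR_ge0 (- (3 / 2 * y)).
  by case: ler0P => _; rewrite ?mulrN; lra.
have i1 := subgaussian_mgf_integrable a; have i2 := subgaussian_mgf_integrable (- a).
have i12 : P.-integrable setT (EFin \o (fun x => expR (a * eps x) + expR (- a * eps x))).
  by have := integrableD measurableT i1 i2; apply: eq_integrable.
have ic : P.-integrable setT
    (EFin \o (fun x => c * (expR (a * eps x) + expR (- a * eps x)))).
  by have := integrableZl measurableT c i12; apply: eq_integrable.
have iw : P.-integrable setT (EFin \o weighted_sqr).
  apply: le_integrable ic => //.
    by apply/measurable_EFinP; exact: measurable_weighted_sqr.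
  move=> x _ /=; rewrite lee_fin ger0_norm ?weighted_sqr_ge0 //.
  by apply: le_trans (ptw x) _; exact: ler_norm.
split=> //; apply: le_trans (le_Rintegral measurableT iw ic (fun x _ => ptw x)) _.
rewrite RintegralZl // RintegralD //.
have ea (b : R) : b ^+ 2 = a ^+ 2 -> \int[P]_x expR (b * eps x) <= expR (9 / 8).
  move=> ba; rewrite -lee_fin EFin_Rintegral; last exact: subgaussian_mgf_integrable.
  apply: le_trans (sg b) _; rewrite lee_fin ler_expR ba /a.
  by rewrite le_eqVlt; apply/orP; left; apply/eqP; field; rewrite gt_eqF.
have h1 := ea a erefl; have h2 := ea (- a) (sqrrN a).
apply: (@le_trans _ _ (c * (2 * expR (9 / 8)))); first by apply: ler_wpM2l => //; lra.
(* The exponent [9 / 8] is the sub-Gaussian one at [3 / 2 / tau]. Numerically [50 / 9 * expR (- (7 /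
   8)) <= 50 / 9 * (8 / 15) < 3]. *)
have -> : c * (2 * expR (9 / 8)) = tau ^+ 2 * (50 / 9 * (expR (-2) * expR (9 / 8))).
  by rewrite /c; ring.
rewrite -expRD mulrC ler_wpM2r ?sqr_ge0 //.
have -> : -2 + 9 / 8 = - (7 / 8) :> R by lra.
have h : expR (- (7 / 8)) <= 8 / 15 :> R.
  rewrite expRN -div1r ler_pdivrMr ?expR_gt0 //.
  have := expR_ge1Dx (7 / 8 : R); lra.
lra.
Qed.

End subgaussian.

Section subgaussian_tails.
Context {R : realType} {d d' : measure_display} {T : measurableType d}
  {Omega : measurableType d'} (P : probability T R) (Q : probability Omega R).
Variables (n : nat) (X : 'I_n -> Omega -> T).
Hypothesis iidX : iid_sample Q P X.
Variables (eps : T -> R) (tau : R).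
Hypotheses (n0 : (0 < n)%N) (tau0 : 0 < tau) (meps : measurable_fun setT eps)
  (sg : subgaussian_fun P eps (tau ^+ 2)).

Lemma noise_tail (L : R) : 0 < L ->
  exists2 bad : set Omega, measurable bad /\ (Q bad <= (2 * expR (- L))%:E)%E &
    forall w, ~ bad w -> `|\sum_i eps (X i w)| <= Num.sqrt (2 * L) * tau * Num.sqrt n%:R.
Proof.
move=> L0; have np : 0 < n%:R :> R by rewrite ltr0n.
have sn0 : 0 < Num.sqrt n%:R :> R by rewrite sqrtr_gt0.
have sn2 : Num.sqrt n%:R ^+ 2 = n%:R :> R by rewrite sqr_sqrtr // ltW.
have sL0 : 0 < Num.sqrt (2 * L) by rewrite sqrtr_gt0 mulr_gt0.
have sL2 : Num.sqrt (2 * L) ^+ 2 = 2 * L by rewrite sqr_sqrtr // mulr_ge0 // ltW.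
pose t := Num.sqrt (2 * L) * tau * Num.sqrt n%:R.
pose l := Num.sqrt (2 * L) / (tau * Num.sqrt n%:R).
have l0 : 0 <= l by rewrite divr_ge0 ?mulr_ge0 // ltW.
have l2 : l ^+ 2 * tau ^+ 2 / 2 = L / n%:R.
  rewrite /l expr_div_n exprMn sL2 sn2; field; rewrite !gt_eqF //.
have m1 : (\int[P]_x (expR (l * eps x))%:E <= (expR (L / n%:R))%:E)%E.
  by rewrite -l2; exact: sg.
have m2 : (\int[P]_x (expR (- l * eps x))%:E <= (expR (L / n%:R))%:E)%E.
  by rewrite -l2 -(sqrrN l); exact: sg.
have [mb Qb] := chernoff_abs_sum iidX t meps l0 m1 m2.
exists [set w | t <= `|\sum_i eps (X i w)|].
  split=> //; apply: le_trans Qb _; rewrite lee_fin ler_wpM2l // ler_expR.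
  have -> : l * t = 2 * L.
    by rewrite -sL2 /l /t; field; rewrite !gt_eqF.
  by rewrite mulrCA divff ?gt_eqF // mulr1; lra.
by move=> w /= /negP; rewrite -ltNge => /ltW.
Qed.

Variables (m : nat) (x : T -> 'cV[R]_m) (M B : R).
Hypotheses (m0 : (0 < m)%N) (B0 : 0 < B)
  (mx : forall j, measurable_fun setT (fun t => x t j ord0))
  (xM : forall j t, `|x t j ord0| <= M)
  (xB : forall t, dotp (x t) (x t) <= B)
  (xeps : forall j, \int[P]_t (eps t * x t j ord0) = 0).

(** Each coordinate is cut at a level proportional to the square root of its own proxy, and the
    proxies sum to at most [4 * B * tau ^+ 2]; the union over coordinates costs [m] only in the
    probability. *)
Lemma cross_tail (L : R) : 0 < L -> 12 * m%:R * L <= n%:R ->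
  exists2 bad : set Omega,
    measurable bad /\ (Q bad <= (2 * m%:R * expR (- L))%:E)%E &
    forall w, ~ bad w ->
      \sum_j (\sum_i eps (X i w) * x (X i w) j ord0) ^+ 2 <=
      16 * B * L * tau ^+ 2 * n%:R.
Proof.
move=> L0 nL; have np : 0 < n%:R :> R by rewrite ltr0n.
have mp : 0 < m%:R :> R by rewrite ltr0n.
have t2 : 0 < tau ^+ 2 by rewrite exprn_gt0.
pose W0 := weighted_sqr eps tau.
have [W0i W0b] := weighted_sqr_bound tau0 meps sg.
have W0_ge0 t : 0 <= W0 t by exact: weighted_sqr_ge0.
pose W j t := x t j ord0 ^+ 2 * W0 t.
have xj2 j t : x t j ord0 ^+ 2 <= B.
  apply: le_trans (xB t); rewrite /dotp (bigD1 j) //= -expr2 lerDl.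
  by apply: sumr_ge0 => k _; rewrite -expr2 sqr_ge0.
have W_ge0 j t : 0 <= W j t by rewrite /W mulr_ge0 ?sqr_ge0.
have mW j : measurable_fun setT (W j).
  by apply: measurable_funM; [exact: measurable_funX | exact: measurable_weighted_sqr].
have BWi : P.-integrable setT (EFin \o (fun t => B * W0 t)).
  by have := integrableZl measurableT B W0i; apply: eq_integrable.
have Wi j : P.-integrable setT (EFin \o W j).
  apply: le_integrable BWi => //; first exact/measurable_EFinP.
  move=> t _ /=; rewrite lee_fin ger0_norm //; apply: le_trans (ler_norm _).
  exact: (ler_wpM2r (W0_ge0 t) (xj2 j t)).
pose Y j t := eps t * x t j ord0.
have mY j : measurable_fun setT (Y j) by exact: measurable_funM.
have MYi : P.-integrable setT (EFin \o (fun t => M * eps t)).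
  have := integrableZl measurableT M (subgaussian_integrable meps sg).
  by apply: eq_integrable.
have Yi j : P.-integrable setT (EFin \o Y j).
  apply: le_integrable MYi => //; first exact/measurable_EFinP.
  move=> t _ /=; rewrite lee_fin !normrM mulrC ler_wpM2r //.
  by apply: le_trans (xM j t) _; exact: ler_norm.
(* The added [B * tau ^+ 2 / m] keeps every proxy away from 0, hence [l j] small enough for the
   weight, while raising the sum only from [3 * B * tau ^+ 2] to [4 * B * tau ^+ 2]. *)
pose kap j := \int[P]_t W j t; pose kap' j := kap j + B * tau ^+ 2 / m%:R.
have kap0 j : 0 <= kap j.
  by apply: Rintegral_ge0 => t _; rewrite mulr_ge0 ?sqr_ge0.
have Bm0 : 0 < B * tau ^+ 2 / m%:R by rewrite divr_gt0 ?mulr_gt0.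
have kap'0 j : 0 < kap' j by rewrite ltr_wpDl.
have skap : \sum_j kap' j <= 4 * B * tau ^+ 2.
  rewrite big_split /= sumr_const card_ord -[_ *+ m]mulr_natr divfK ?gt_eqF //.
  suff : \sum_j kap j <= B * (3 * tau ^+ 2) by lra.
  apply: (@le_trans _ _ (B * \int[P]_t W0 t)); last by apply: ler_wpM2l => //; exact: ltW.
  rewrite -RintegralZl // -Rintegral_sum //; apply: le_Rintegral => //.
    exact: integrable_sumr.
  move=> t _; rewrite /W -mulr_suml ler_wpM2r //; apply: le_trans (xB t).
  by apply: ler_sum => j _; rewrite expr2.
pose l j := Num.sqrt (L / (n%:R * kap' j)).
have l2 j : l j ^+ 2 = L / (n%:R * kap' j).
  by rewrite sqr_sqrtr // divr_ge0 ?mulr_ge0 // ltW.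
have l0 j : 0 < l j by rewrite sqrtr_gt0 divr_gt0 ?mulr_gt0.
(* The square is at most [m * L / (n * tau ^+ 2) <= 1 / (12 * tau ^+ 2)], and
   [1 / 12 <= (3 / 10) ^+ 2]. *)
have lx j t : `|l j * x t j ord0| <= 3 / 10 / tau.
  rewrite -ler_sqr ?nnegrE //; last by rewrite divr_ge0 // ltW.
  rewrite real_normK ?num_real // exprMn expr_div_n l2 mulrAC.
  rewrite ler_pdivrMr ?mulr_gt0 // mulrAC ler_pdivlMr //.
  have h1 : x t j ord0 ^+ 2 * (tau ^+ 2 * L) <= B * (tau ^+ 2 * L).
    by apply: ler_wpM2r => //; rewrite mulr_ge0 // ltW.
  have h2 : B * tau ^+ 2 <= m%:R * kap' j.
    by rewrite mulrDr [m%:R * (_ / _)]mulrC divfK ?gt_eqF // lerDr mulr_ge0 // ltW.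
  have h3 : B * tau ^+ 2 * L <= m%:R * kap' j * L by rewrite ler_pM2r.
  have h4 : 12 * m%:R * L * kap' j <= n%:R * kap' j by rewrite ler_pM2r.
  have h5 : 0 < n%:R * kap' j by rewrite mulr_gt0.
  lra.
have mgfY j (l' : R) : `|l'| = l j ->
    (\int[P]_t (expR (l' * Y j t))%:E <= (expR (L / n%:R))%:E)%E.
  move=> l'E; have l'2 : l' ^+ 2 = l j ^+ 2 by rewrite -l'E real_normK ?num_real.
  apply: le_trans (mgf_le (Yi j) (Wi j) (xeps j) _) _.
    move=> t; apply: le_trans (expR_le_quad_expR _) _; rewrite lerD2l.
    have -> : l' ^+ 2 * W j t = (l' * Y j t) ^+ 2 * expR (3 / 10 * `|eps t / tau|).
      by rewrite /W /W0 /weighted_sqr /Y; ring.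
    rewrite ler_wpM2l ?sqr_ge0 // ler_expR /Y mulrCA normrM.
    have -> : 3 / 10 * `|eps t / tau| = `|eps t| * (3 / 10 / tau).
      by rewrite normrM normfV (ger0_norm (ltW tau0)); ring.
    rewrite ler_wpM2l // normrM l'E.
    by have := lx j t; rewrite normrM (ger0_norm (ltW (l0 j))).
  rewrite lee_fin ler_expR l'2 l2 mulrAC ler_pdivrMr ?mulr_gt0 //.
  rewrite mulrA divfK ?gt_eqF // ler_pM2l // lerDl ltW //.
(* The choice of [l j] makes the exponential moment contribute at most [L], so the exponent is
   [L - 2 * L]; the squared level is [4 * L * n * kap' j]. *)
pose thr j := 2 * L / l j.
pose bad j := [set w | thr j <= `|\sum_i Y j (X i w)|].
have cher j : measurable (bad j) /\ (Q (bad j) <= (2 * expR (- L))%:E)%E.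
  have ln : `|- l j| = l j by rewrite normrN ger0_norm // ltW.
  have lp : `|l j| = l j by rewrite ger0_norm // ltW.
  have [mb Qb] := chernoff_abs_sum iidX (thr j) (mY j) (ltW (l0 j)) (mgfY j _ lp) (mgfY j _ ln).
  split=> //; apply: le_trans Qb _; rewrite lee_fin ler_wpM2l // ler_expR.
  have -> : l j * thr j = 2 * L by rewrite /thr mulrC divfK ?gt_eqF.
  by rewrite mulrC divfK ?gt_eqF //; lra.
have [mU QU] := measure_bigsetU_le Q (index_enum 'I_m) (fun j => (cher j).1).
exists (\big[setU/set0]_j bad j).
  split=> //; apply: le_trans QU _.
  apply: (@le_trans _ _ (\sum_(j < m) (2 * expR (- L))%:E)%E).
    by apply: lee_sum => j _; exact: (cher j).2.
  by rewrite sumEFin lee_fin sumr_const card_ord -mulr_natl; lra.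
move=> w nbad.
apply: (@le_trans _ _ (\sum_j 4 * L * n%:R * kap' j)).
  apply: ler_sum => j _.
  have nb : ~ bad j w.
    by move=> bj; apply: nbad; rewrite -bigcup_seq; exists j => //=; rewrite mem_index_enum.
  move/negP: nb; rewrite /bad /= -ltNge => /ltW h.
  rewrite -(real_normK (num_real _)).
  apply: (@le_trans _ _ (thr j ^+ 2)).
    by apply: lerXn2r; rewrite ?nnegrE ?normr_ge0 // /thr divr_ge0 ?mulr_ge0 // ltW.
  rewrite /thr expr_div_n l2 le_eqVlt; apply/orP; left; apply/eqP.
  by field; rewrite !gt_eqF.
rewrite -mulr_sumr.
have : 4 * L * n%:R * \sum_j kap' j <= 4 * L * n%:R * (4 * B * tau ^+ 2).
  by apply: ler_wpM2l => //; rewrite !mulr_ge0 // ltW.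
lra.
Qed.

End subgaussian_tails.

(** * Whitening and the deterministic error bound *)

(** An inverse Cholesky factor, built by induction: one elimination step leaves the Schur complement
    [D'] of the leading entry. *)
Lemma whitening (R : rcfType) (m : nat) (G : 'M[R]_m) :
  G^T = G -> (forall v : 'cV_m, v != 0 -> 0 < (v^T *m G *m v) ord0 ord0) ->
  exists S : 'M[R]_m, S *m G *m S^T = 1%:M.
Proof.
elim: m G => [|m IH] G sG pG; first by exists 0; apply/matrixP => -[].
pose G' : 'M[R]_(1 + m) := G.
pose a : R := ulsubmx G' ord0 ord0; pose b := dlsubmx G'; pose D := drsubmx G'.
have sG' : G'^T = G' := sG.
have pG' (v : 'cV[R]_(1 + m)) : v != 0 -> 0 < (v^T *m G' *m v) ord0 ord0 := pG v.
have GE : G' = block_mx a%:M b^T b D.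
  by rewrite -[LHS]submxK -mx11_scalar /b trmx_dlsub sG'.
have sD : D^T = D by rewrite trmx_drsub sG'.
have a0 : 0 < a.
  have nz : (col_mx 1%:M 0 : 'cV[R]_(1 + m)) != 0.
    apply/eqP => /matrixP /(_ (lshift m ord0) ord0); rewrite col_mxEu !mxE eqxx.
    by move/eqP; rewrite oner_eq0.
  have := pG' _ nz; rewrite GE tr_col_mx trmx1 trmx0 mul_row_block mul_row_col.
  by rewrite !mul1mx !mul0mx !addr0 !mulmx0 addr0 mulmx1 mxE eqxx mulr1n.
have an0 : a != 0 by rewrite gt_eqF.
pose D' := D - a^-1 *: (b *m b^T).
have [S' HS'] : exists S' : 'M[R]_m, S' *m D' *m S'^T = 1%:M.
  apply: IH; first by rewrite linearB linearZ /= sD trmx_mul trmxK.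
  (* For fixed [v] this first entry minimises the form of [G'], and the minimum is the form of [D']
     at [v]; hence [D'] is positive definite. *)
  move=> v v0; pose w : 'cV[R]_(1 + m) := col_mx (- a^-1 *: (b^T *m v)) v.
  have nz : w != 0.
    apply: contra_neq v0 => w0; rewrite -[v](col_mxKd (- a^-1 *: (b^T *m v))).
    by rewrite -/w w0 linear0.
  have := pG' _ nz; rewrite -mulmxA GE /w mul_block_col.
  rewrite -scalemxAr mul_scalar_mx scalerA mulNr mulVf // scaleN1r addNr.
  rewrite tr_col_mx mul_row_col mulmx0 add0r.
  have -> : b *m (- a^-1 *: (b^T *m v)) + D *m v = D' *m v.
    by rewrite /D' mulmxBl -scalemxAl -scalemxAr scaleNr mulmxA addrC.
  by rewrite mulmxA.
pose c := (Num.sqrt a)^-1.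
have c2 : c * a * c = 1.
  by rewrite mulrAC -expr2 /c exprVn sqr_sqrtr ?mulVf // ltW.
pose S0 : 'M[R]_(1 + m) := block_mx c%:M 0 (- a^-1 *: b) 1%:M.
pose S1 : 'M[R]_(1 + m) := block_mx 1%:M 0 0 S'.
exists (S1 *m S0).
have S0G : S0 *m G' *m S0^T = block_mx 1%:M 0 0 D'.
  rewrite GE /S0 tr_block_mx !mulmx_block.
  rewrite !(mul0mx, mulmx0, trmx0, trmx1, mul1mx, mulmx1, addr0, add0r).
  have Z : - a^-1 *: b *m a%:M + b = 0.
    by rewrite mul_mx_scalar scalerA mulrN mulfV // scaleN1r addNr.
  rewrite !Z !(mul0mx, add0r) !tr_scalar_mx -!scalar_mxM c2.
  congr block_mx; last by rewrite /D' -scalemxAl scaleNr addrC.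
  rewrite linearZ /= -scalemxAr !mul_scalar_mx scalerA -scalerDl.
  by rewrite (_ : _ + c = 0) ?scale0r //; field.
suff H : S1 *m S0 *m G' *m (S1 *m S0)^T = 1%:M by exact: H.
rewrite trmx_mul -!mulmxA (mulmxA S0) (mulmxA (S0 *m _)) S0G.
rewrite /S1 tr_block_mx !mulmx_block.
rewrite !(mul0mx, mulmx0, trmx0, trmx1, mul1mx, mulmx1, addr0, add0r).
by rewrite mulmxA HS' -scalar_mx_block.
Qed.

Section least_squares.
Context {R : realType}.

Lemma quadratic_min (a b : R) : 0 <= b -> (forall s, 0 <= - (2 * s * a) + s ^+ 2 * b) ->
  a = 0.
Proof.
move=> b0 H; apply/eqP; rewrite -sqrf_eq0 eq_le sqr_ge0 andbT.
have b1 : 0 < b + 1 by lra.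
(* The minimiser would be [a / b]; [b + 1] avoids the case [b = 0]. *)
have := H (a / (b + 1)); rewrite -(pmulr_rge0 _ (exprn_gt0 2 b1)).
have -> : (b + 1) ^+ 2 * (- (2 * (a / (b + 1)) * a) + (a / (b + 1)) ^+ 2 * b) =
  - (a ^+ 2 * (b + 2)) by field; rewrite gt_eqF.
rewrite oppr_ge0 pmulr_lle0 //; lra.
Qed.

Lemma sum_orthogonal_of_min (n : nat) (r g : 'I_n -> R) :
  (forall s, \sum_i r i ^+ 2 <= \sum_i (r i - s * g i) ^+ 2) ->
  \sum_i r i * g i = 0.
Proof.
move=> H; apply: (@quadratic_min _ (\sum_i g i ^+ 2)).
  by apply: sumr_ge0 => i _; exact: sqr_ge0.
move=> s; rewrite -(lerD2l (\sum_i r i ^+ 2)) addr0; apply: le_trans (H s) _.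
rewrite le_eqVlt; apply/orP; left; apply/eqP.
rewrite !mulr_sumr -sumrN -!big_split /=.
by apply: eq_bigr => i _; ring.
Qed.

Lemma lincomb_shift (T : Type) (m : nat) (h : 'I_m -> T -> R) (beta c : 'I_m -> R)
    (s : R) (t : T) :
  \sum_j (beta j + s * c j) * h j t = (\sum_j beta j * h j t) + s * \sum_j c j * h j t.
Proof. by rewrite mulr_sumr -big_split /=; apply: eq_bigr => j _; ring. Qed.

(* [w] and [v] are the empirical means of [eps y] and [y], [e] that of [eps];
   the normal equations read [e = a + g.v] and [g.w = a g.v + mean (g.y)^2]. *)
Lemma least_squares_bound (n m : nat) (eps : 'I_n -> R) (y : 'I_n -> 'cV[R]_m)
    (a p q tau E0 : R) (g : 'cV[R]_m) :
  (0 < n)%N -> 0 <= p -> 0 <= q -> 0 < tau ->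
  (forall u : 'cV[R]_m, n%:R / 3 * dotp u u <= \sum_i dotp (y i) u ^+ 2) ->
  \sum_i (eps i - a - dotp g (y i)) = 0 ->
  \sum_i (eps i - a - dotp g (y i)) * dotp g (y i) = 0 ->
  \sum_j (\sum_i y i j ord0) ^+ 2 <= (11 / 4 * p * n%:R) ^+ 2 ->
  \sum_j (\sum_i eps i * y i j ord0) ^+ 2 <= (4 * q * tau * n%:R) ^+ 2 ->
  `|\sum_i eps i| <= E0 * n%:R ->
  E0 * p * (11 / 4) <= 9 / 20 * q * tau -> p ^+ 2 <= 1 / 75 ->
  `|a| <= E0 + 58 * p * q * tau.
Proof.
move=> n0 p0 q0 tau0 Hg H1 H2 Hv Hw He HE p75.
have np : 0 < n%:R :> R by rewrite ltr0n.
have nn0 : n%:R != 0 :> R by rewrite gt_eqF.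
pose v : 'cV[R]_m := \col_j ((\sum_i y i j ord0) / n%:R).
pose w : 'cV[R]_m := \col_j ((\sum_i eps i * y i j ord0) / n%:R).
pose e := (\sum_i eps i) / n%:R.
have e0 : `|e| <= E0 by rewrite normrM normfV (ger0_norm (ltW np)) ler_pdivrMr.
have vv : dotp v v <= (11 / 4 * p) ^+ 2.
  rewrite /dotp (eq_bigr (fun j => (\sum_i y i j ord0) ^+ 2 / n%:R ^+ 2)); last first.
    by move=> j _; rewrite mxE; field.
  by rewrite -mulr_suml ler_pdivrMr ?exprn_gt0 // -exprMn.
have ww : dotp w w <= (4 * q * tau) ^+ 2.
  rewrite /dotp (eq_bigr (fun j => (\sum_i eps i * y i j ord0) ^+ 2 / n%:R ^+ 2)); last first.
    by move=> j _; rewrite mxE; field.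
  by rewrite -mulr_suml ler_pdivrMr ?exprn_gt0 // -exprMn.
have gv : dotp g v = (\sum_i dotp g (y i)) / n%:R.
  rewrite exchange_big /= mulr_suml; apply: eq_bigr => j _.
  by rewrite mxE -mulr_sumr mulrA.
have gw : dotp g w = (\sum_i eps i * dotp g (y i)) / n%:R.
  rewrite (eq_bigr (fun i => \sum_j g j ord0 * (eps i * y i j ord0))); last first.
    by move=> i _; rewrite mulr_sumr; apply: eq_bigr => j _; rewrite mulrCA.
  rewrite exchange_big /= mulr_suml; apply: eq_bigr => j _.
  by rewrite mxE -mulr_sumr mulrA.
have E1 : e = a + dotp g v.
  rewrite gv /e; apply: (mulIf nn0); rewrite mulrDl !divfK //.
  move: H1; rewrite !sumrB sumr_const card_ord -[a *+ n]mulr_natr; lra.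
pose A := (\sum_i dotp g (y i) ^+ 2) / n%:R.
have E2 : dotp g w = a * dotp g v + A.
  rewrite gv gw /A; apply: (mulIf nn0); rewrite mulrDl mulrA !divfK //.
  have : \sum_i (eps i - a - dotp g (y i)) * dotp g (y i) =
     \sum_i eps i * dotp g (y i) - a * (\sum_i dotp g (y i)) - \sum_i dotp g (y i) ^+ 2.
    by rewrite mulr_sumr -!sumrB; apply: eq_bigr => i _; ring.
  rewrite H2; lra.
have Ag : dotp g g / 3 <= A.
  rewrite /A ler_pdivlMr //; apply: le_trans (le_trans _ (Hg g)) _; first lra.
  by apply: ler_sum => i _; rewrite dotpC.
pose N := Num.sqrt (dotp g g).
have N0 : 0 <= N by exact: sqrtr_ge0.
have N2 : dotp g g <= N ^+ 2 by rewrite sqr_sqrtr // dotp_ge0.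
have N2' : dotp g g = N ^+ 2 by rewrite sqr_sqrtr // dotp_ge0.
have V0 : 0 <= 11 / 4 * p by lra.
have W0 : 0 <= 4 * q * tau by rewrite !mulr_ge0 // ltW.
have gvN := normr_dotp_le N0 V0 N2 vv.
have gwN := normr_dotp_le N0 W0 N2 ww.
have E00 : 0 <= E0 by apply: le_trans e0; exact: normr_ge0.
(* Eliminating [a] between the normal equations gives [A = g.w - e (g.v) + (g.v)^2]; each term is
   bounded by Cauchy-Schwarz. *)
have key : N ^+ 2 / 3 <= N * (4 * q * tau) + E0 * (N * (11 / 4 * p)) + (N * (11 / 4 * p)) ^+ 2.
  rewrite -N2'; apply: le_trans Ag _.
  have -> : A = dotp g w - e * dotp g v + dotp g v ^+ 2 by rewrite E1; move: E2; lra.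
  apply: lerD; first apply: lerD.
  - by apply: le_trans (ler_norm _) gwN.
  - apply: le_trans (ler_norm _) _; rewrite normrN normrM; exact: ler_pM.
  - rewrite -(real_normK (num_real (dotp g v))).
    by apply: lerXn2r; rewrite ?nnegrE ?normr_ge0 // mulr_ge0.
have qt0 : 0 <= q * tau by rewrite mulr_ge0 // ltW.
(* After division by [N]: [93 / 400 = 1 / 3 - (11 / 4) ^+ 2 / 75] and [89 / 20 = 4 + 9 / 20]. *)
have NB : N * (93 / 400) <= 89 / 20 * (q * tau).
  have [->|Nn0] := eqVneq N 0; first by lra.
  have Np : 0 < N by rewrite lt_def Nn0.
  rewrite -(ler_pM2l Np).
  have h1 : N * (E0 * p * (11 / 4)) <= N * (9 / 20 * q * tau) by rewrite ler_pM2l.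
  have h2 : N ^+ 2 * p ^+ 2 <= N ^+ 2 * (1 / 75) by rewrite ler_wpM2l ?sqr_ge0.
  lra.
(* The correction [g.v] is at most [11 / 4 * (89 / 20) * (400 / 93) * p * q * tau], with a constant
   below 53. *)
have -> : a = e - dotp g v by rewrite E1; ring.
apply: le_trans (ler_normB _ _) _; apply: lerD => //; apply: le_trans gvN _.
have : p * (N * (93 / 400)) <= p * (89 / 20 * (q * tau)) by exact: ler_wpM2l.
have : 0 <= p * (q * tau) by exact: mulr_ge0.
lra.
Qed.

End least_squares.

(** * Population moments *)

Section population.
Context {R : realType} {d : measure_display} {T : measurableType d} (P : probability T R).

Lemma integral_orthogonal_of_min (r g : T -> R) :
  P.-integrable setT (EFin \o (fun t => r t ^+ 2)) ->
  P.-integrable setT (EFin \o (fun t => r t * g t)) ->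
  P.-integrable setT (EFin \o (fun t => g t ^+ 2)) ->
  (forall s, \int[P]_t (r t ^+ 2) <= \int[P]_t ((r t - s * g t) ^+ 2)) ->
  \int[P]_t (r t * g t) = 0.
Proof.
move=> r2 rg g2 H; apply: (@quadratic_min _ _ (\int[P]_t (g t ^+ 2))).
  by apply: Rintegral_ge0 => t _; exact: sqr_ge0.
move=> s; rewrite -(lerD2l (\int[P]_t (r t ^+ 2))) addr0; apply: le_trans (H s) _.
have i1 : P.-integrable setT (EFin \o (fun t => - (2 * s) * (r t * g t))).
  by have := integrableZl measurableT (- (2 * s)) rg; apply: eq_integrable.
have i2 : P.-integrable setT (EFin \o (fun t => s ^+ 2 * g t ^+ 2)).
  by have := integrableZl measurableT (s ^+ 2) g2; apply: eq_integrable.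
have i12 : P.-integrable setT
    (EFin \o (fun t => - (2 * s) * (r t * g t) + s ^+ 2 * g t ^+ 2)).
  by have := integrableD measurableT i1 i2; apply: eq_integrable.
rewrite -mulNr -(RintegralZl _ measurableT rg) -(RintegralZl _ measurableT g2).
rewrite -RintegralD // -RintegralD // le_eqVlt; apply/orP; left; apply/eqP.
by apply: eq_Rintegral => t _; ring.
Qed.

Section bounded_variates.
Variables (m : nat) (h : 'I_m -> T -> R) (U : R).
Hypotheses (mh : forall j, measurable_fun setT (h j)) (hU : forall j t, `|h j t| <= U).

Let hi j : P.-integrable setT (EFin \o h j).
Proof. exact: bounded_integrable (hU j). Qed.

Let hhi j k : P.-integrable setT (EFin \o (fun t => h j t * h k t)).
Proof.
apply: (@bounded_integrable _ _ _ _ _ (U * U)); first exact: measurable_funM.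
by move=> t; rewrite normrM; apply: ler_pM.
Qed.

Lemma measurable_lincomb (c : 'I_m -> R) : measurable_fun setT (lincomb c h).
Proof. by apply: measurable_sum => j; exact: measurable_funM. Qed.

Lemma whitened_coord (S : 'M[R]_m) j t :
  (S *m hvec h t) j ord0 = lincomb (S j) h t.
Proof. by rewrite mxE; apply: eq_bigr => k _; rewrite mxE. Qed.

Lemma lincomb_le (c : 'I_m -> R) t : `|lincomb c h t| <= (\sum_j `|c j|) * U.
Proof.
apply: le_trans (ler_norm_sum _ _ _) _; rewrite mulr_suml; apply: ler_sum => j _.
by rewrite normrM ler_wpM2l.
Qed.

Lemma lincomb_mul (b c : 'I_m -> R) t :
  lincomb b h t * lincomb c h t = \sum_j \sum_k (b j * c k) * (h j t * h k t).
Proof.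
rewrite mulr_suml; apply: eq_bigr => j _; rewrite mulr_sumr.
by apply: eq_bigr => k _; ring.
Qed.

Lemma integral_lincomb_mul (b c : 'I_m -> R) :
  \int[P]_t (lincomb b h t * lincomb c h t) =
  \sum_j \sum_k b j * c k * gram P h j k.
Proof.
have ci j k : P.-integrable setT (EFin \o (fun t => (b j * c k) * (h j t * h k t))).
  by have := integrableZl measurableT (b j * c k) (hhi j k); apply: eq_integrable.
under eq_Rintegral do rewrite lincomb_mul.
rewrite Rintegral_sum; last by move=> j; exact: integrable_sumr.
apply: eq_bigr => j _; rewrite Rintegral_sum //; apply: eq_bigr => k _.
by rewrite RintegralZl // mxE.
Qed.

Lemma integral_lincomb (r : T -> R) (c : 'I_m -> R) :
  (forall j, P.-integrable setT (EFin \o (fun t => r t * h j t))) ->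
  \int[P]_t (r t * lincomb c h t) = \sum_j c j * \int[P]_t (r t * h j t).
Proof.
move=> ri.
have ci j : P.-integrable setT (EFin \o (fun t => c j * (r t * h j t))).
  by have := integrableZl measurableT (c j) (ri j); apply: eq_integrable.
transitivity (\int[P]_t (\sum_j c j * (r t * h j t))).
  by apply: eq_Rintegral => t _; rewrite mulr_sumr; apply: eq_bigr => j _; rewrite mulrCA.
by rewrite Rintegral_sum //; apply: eq_bigr => j _; rewrite RintegralZl.
Qed.

Lemma gramT : (gram P h)^T = gram P h.
Proof.
by apply/matrixP => i j; rewrite !mxE; apply: eq_Rintegral => t _; rewrite mulrC.
Qed.

Lemma quadratic_form (G : 'M[R]_m) (u v : 'cV[R]_m) :
  (u^T *m G *m v) ord0 ord0 = \sum_j \sum_k u j ord0 * v k ord0 * G j k.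
Proof.
rewrite exchange_big mxE; apply: eq_bigr => k _; rewrite mxE mulr_suml.
by apply: eq_bigr => j _; rewrite mxE; ring.
Qed.

Lemma whitened_cov (S : 'M[R]_m) a b :
  \int[P]_t ((S *m hvec h t) a ord0 * (S *m hvec h t) b ord0) =
  (S *m gram P h *m S^T) a b.
Proof.
transitivity (\int[P]_t (lincomb (S a) h t * lincomb (S b) h t)).
  by apply: eq_Rintegral => t _; rewrite !whitened_coord.
rewrite integral_lincomb_mul exchange_big mxE; apply: eq_bigr => k _.
rewrite !mxE mulr_suml; apply: eq_bigr => j _; ring.
Qed.

Lemma gram_pos : (forall beta : 'I_m -> R,
    {ae P, forall x, lincomb beta h x = 0} -> beta = (fun _ => 0)) ->
  forall v : 'cV[R]_m, v != 0 -> 0 < (v^T *m gram P h *m v) ord0 ord0.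
Proof.
move=> indep v v0; pose c j := v j ord0.
have E : (v^T *m gram P h *m v) ord0 ord0 = \int[P]_t (lincomb c h t ^+ 2).
  by rewrite quadratic_form -integral_lincomb_mul.
rewrite E lt_def Rintegral_ge0 ?andbT; last by move=> t _; exact: sqr_ge0.
apply: contra_neq v0 => I0.
have mc := measurable_lincomb c.
have ci : P.-integrable setT (EFin \o (fun t => lincomb c h t ^+ 2)).
  apply: (@bounded_integrable _ _ _ _ _ (((\sum_j `|c j|) * U) ^+ 2)).
    exact: measurable_funX.
  by move=> t; rewrite normrX lerXn2r ?nnegrE ?normr_ge0 ?lincomb_le //;
    apply: le_trans (lincomb_le c t); exact: normr_ge0.
have : (\int[P]_t `|(lincomb c h t ^+ 2)%:E| = 0)%E.
  transitivity (\int[P]_t (lincomb c h t ^+ 2)%:E)%E.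
    by apply: eq_integral => t _; rewrite gee0_abs // lee_fin sqr_ge0.
  by rewrite -EFin_Rintegral // I0.
move/ae_eq_integral_abs => /(_ measurableT (measurable_int _ ci)) ae0.
have c0 : c = (fun=> 0).
  apply: indep; apply: filterS ae0 => t /= /(_ I) /eqP.
  by rewrite eqe sqrf_eq0 => /eqP.
apply/matrixP => j k; rewrite ord1 mxE.
by have /(congr1 (@^~ j)) := c0.
Qed.

(** The whitening identity says that [S^T *m S] is the inverse of the Gram matrix. *)
Lemma whitened_sqr (S : 'M[R]_m) t : S *m gram P h *m S^T = 1%:M ->
  dotp (S *m hvec h t) (S *m hvec h t) =
  ((hvec h t)^T *m invmx (gram P h) *m hvec h t) ord0 ord0.
Proof.
move=> HS.
have GSS : gram P h *m (S^T *m S) = 1%:M.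
  by rewrite mulmxA; apply: mulmx1C; rewrite mulmxA.
have -> : invmx (gram P h) = S^T *m S.
  by rewrite -[LHS]mulmx1 -GSS mulKmx //; case: (mulmx1_unit GSS).
have := dotpE (S *m hvec h t) (S *m hvec h t).
rewrite trmx_mul => /matrixP /(_ ord0 ord0); rewrite [in RHS]mxE eqxx mulr1n => <-.
by rewrite !mulmxA.
Qed.

Lemma whitened_le_Bconst (S : 'M[R]_m) t : S *m gram P h *m S^T = 1%:M ->
  dotp (S *m hvec h t) (S *m hvec h t) <= Bconst P h.
Proof.
move=> HS; rewrite whitened_sqr //; apply: ub_le_sup; last by exists t.
(* A real [sup] is an upper bound only of a set that has one; the bound on the variates supplies
   it. *)
exists (\sum_j ((\sum_k `|S j k|) * U) ^+ 2) => _ [t' _ <-].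
rewrite -(whitened_sqr _ HS); apply: ler_sum => j _.
rewrite whitened_coord -expr2 -(real_normK (num_real _)).
by rewrite lerXn2r ?nnegrE ?normr_ge0 ?lincomb_le //;
  apply: le_trans (lincomb_le (S j) t'); exact: normr_ge0.
Qed.

End bounded_variates.

End population.

(** * Assembling the bound *)

Section normal_equations.
Context {R : realType} {d : measure_display} {T : measurableType d}.
Variables (n m : nat) (f : T -> R) (h : 'I_m -> T -> R) (xs : 'I_n -> T)
  (alpha : R) (beta : 'I_m -> R).
Hypothesis ols : is_ols f h xs alpha beta.

Let r i := f (xs i) - alpha - lincomb beta h (xs i).

Lemma ols_sum_residuals : \sum_i r i = 0.
Proof.
rewrite -[LHS](_ : \sum_i r i * 1 = _); last by apply: eq_bigr => i _; rewrite mulr1.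
apply: sum_orthogonal_of_min => s; apply: le_trans (ols (alpha + s) beta) _.
by rewrite le_eqVlt; apply/orP; left; apply/eqP; apply: eq_bigr => i _; rewrite /r; ring.
Qed.

Lemma ols_orthogonal (c : 'I_m -> R) : \sum_i r i * lincomb c h (xs i) = 0.
Proof.
apply: sum_orthogonal_of_min => s.
apply: le_trans (ols alpha (fun j => beta j + s * c j)) _.
rewrite le_eqVlt; apply/orP; left; apply/eqP; apply: eq_bigr => i _.
by rewrite /r /lincomb lincomb_shift; ring.
Qed.

End normal_equations.

Section rates.
Context {R : realType}.
Implicit Types (delta M N B L : R).

(** Since [a >= 4], [ln 2] is at most half of [ln a]. *)
Lemma ln_double_le (a : R) : 4 <= a -> ln (2 * a) <= 3 / 2 * ln a.
Proof.
move=> a4; have a0 : 0 < a by lra.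
rewrite lnM ?posrE //.
have : ln 4 <= ln a by rewrite ler_ln ?posrE.
have -> : ln 4 = 2 * ln 2 :> R.
  rewrite (_ : 4 = 2 * 2); last by lra.
  by rewrite lnM ?posrE //; lra.
lra.
Qed.

Lemma log_levels delta M : 0 < delta -> delta < 1 -> 1 <= M ->
  [/\ 4 / 3 <= ln (4 / delta), ln (4 / delta) <= ln (4 * M / delta),
      ln (8 * M / delta) <= 3 / 2 * ln (4 * M / delta),
      ln (8 / delta) <= ln (8 * M / delta) & 0 < ln (8 / delta)].
Proof.
move=> d0 d1 M1; have M0 : 0 < M by lra.
have di1 : 1 <= delta^-1 by rewrite invf_ge1 // ltW.
have di0 : 0 < delta^-1 by rewrite invr_gt0.
have a4 : 4 <= 4 / delta by lra.
have le_scale (c : R) : 0 < c -> c / delta <= c * M / delta.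
  by move=> c0; rewrite ler_pM2r // ler_peMr // ltW.
have a4m := le_scale 4 (ltr0Sn _ _); have a8m := le_scale 8 (ltr0Sn _ _).
split.
- by apply: le_trans ln4_ge _; rewrite ler_ln ?posrE ?divr_gt0.
- by rewrite ler_ln ?posrE ?divr_gt0 ?mulr_gt0.
- rewrite (_ : 8 * M / delta = 2 * (4 * M / delta)); last by ring.
  by apply: ln_double_le; lra.
- by rewrite ler_ln ?posrE ?divr_gt0 ?mulr_gt0.
- by apply: ln_gt0; lra.
Qed.

Lemma sqrt_rate_mul N (a b : R) : 0 < N -> 0 <= a -> 0 <= b ->
  Num.sqrt (a / N) * Num.sqrt (b / N) = Num.sqrt (a * b) / N.
Proof.
move=> N0 a0 b0; have Ni : 0 <= N^-1 by rewrite invr_ge0 ltW.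
rewrite -sqrtrM ?mulr_ge0 // mulrACA -expr2 sqrtrM ?mulr_ge0 //.
by rewrite sqrtr_sqr ger0_norm.
Qed.

(** After squaring, the constant is [2 * (11 / 4) ^+ 2 / 75 = 121 / 600], just below
    [(9 / 20) ^+ 2 = 81 / 400]. *)
Lemma noise_rate_le N L (b p q : R) : 0 < N -> 0 <= L -> L <= b -> 0 <= p -> 0 <= q ->
  p ^+ 2 <= 1 / 75 -> q ^+ 2 = b / N ->
  Num.sqrt (2 * L) / Num.sqrt N * p * (11 / 4) <= 9 / 20 * q.
Proof.
move=> N0 L0 Lb p0 q0 p75 qE.
rewrite -ler_sqr ?nnegrE ?mulr_ge0 ?divr_ge0 ?sqrtr_ge0 //.
rewrite !exprMn exprVn !sqr_sqrtr ?mulr_ge0 ?(ltW N0) // qE.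
have LN : 0 <= L / N by rewrite divr_ge0 // ltW.
have h1 : L / N * p ^+ 2 <= L / N * (1 / 75) by rewrite ler_wpM2l.
have h2 : L / N <= b / N by rewrite ler_pM2r ?invr_gt0.
lra.
Qed.

Lemma cross_prob_le M delta : 0 < M -> 0 < delta ->
  2 * M * (8 * M / delta)^-1 = delta / 4.
Proof. by move=> M0 d0; field; rewrite !gt_eqF. Qed.

Lemma gram_prob_le N M B L delta : 0 < B -> 0 < M -> 0 < delta ->
  4 / 3 <= L -> L = ln (4 * M / delta) -> 18 * B * L <= N ->
  M * expR (- (7 / 54 * (N / B)) + 1 / 18) <= delta / 4.
Proof.
move=> B0 M0 d0 L43 LE NB.
have -> : delta / 4 = M * expR (- L).
  rewrite LE expRN lnK ?posrE ?divr_gt0 ?mulr_gt0 //.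
  by field; rewrite !gt_eqF.
rewrite ler_pM2l // ler_expR.
(* [7 / 54 * 18 = 7 / 3], so a surplus of [4 / 3 * L] absorbs [1 / 18]. *)
have : 18 * L <= N / B by rewrite ler_pdivlMr // mulrAC.
lra.
Qed.

End rates.

Theorem theorem1 (R : realType) (d : measure_display) (T : measurableType d)
    (P : probability T R) (f : T -> R) (m : nat) (h : 'I_m -> T -> R)
    (betastar : 'I_m -> R) (tau : R) :
  (0 < m)%N ->
  inL2 P f ->
  (forall j, inL2 P (h j)) ->
  (forall j, PE P (h j) = 0) ->
  (forall beta : 'I_m -> R, pop_risk P f h betastar <= pop_risk P f h beta) ->
  0 < tau ->
  subgaussian_fun P (fun x => f x - PE P f - lincomb betastar h x) (tau ^+ 2) ->
  (exists U : R, forall j x, `|h j x| <= U) ->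
  (forall beta : 'I_m -> R,
      {ae P, forall x, lincomb beta h x = 0} -> beta = (fun _ => 0)) ->
  forall (delta : R) (n : nat),
  0 < delta < 1 ->
  18 * Bconst P h * ln (4 * m%:R / delta) <= n%:R ->
  75 * m%:R * ln (4 / delta) <= n%:R ->
  forall (d' : measure_display) (Omega : measurableType d')
         (Q : probability Omega R) (X : 'I_n -> Omega -> T),
  iid_sample Q P X ->
  exists E : set Omega, measurable E /\ (1 - delta%:E <= Q E)%E /\
    forall omega, E omega ->
    forall (alpha : R) (beta : 'I_m -> R),
      is_ols f h (fun i => X i omega) alpha beta ->
      `|alpha - PE P f| <=
        Num.sqrt (2 * ln (8 / delta)) * tau / Num.sqrt n%:R
        + 58 * Num.sqrt (Bconst P h * m%:R * ln (8 * m%:R / delta) * ln (4 / delta))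
            * tau / n%:R.
Proof.
move=> m0 [mf _] h2 hP opt tau0 sg [U' hU'] indep delta n /andP[d0 d1] nB nm.
pose U := `|U'|; have U0 : 0 <= U by exact: normr_ge0.
have hU j t : `|h j t| <= U by apply: le_trans (hU' j t) _; exact: ler_norm.
move=> d' Omega Q X iidX.
have mh j : measurable_fun setT (h j) := (h2 j).1.
set eps := fun x => _ - _ - _ in sg.
set B := Bconst P h in nB *.
have meps : measurable_fun setT eps.
  apply: measurable_funB; last exact: measurable_lincomb.
  exact: measurable_funB.
have hi j : P.-integrable setT (EFin \o h j) by exact: bounded_integrable (hU j).
have epsi := subgaussian_integrable meps sg.
have ehi j : P.-integrable setT (EFin \o (fun t => eps t * h j t)).
  have Uei : P.-integrable setT (EFin \o (fun t => U * eps t)).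
    by have := integrableZl measurableT U epsi; apply: eq_integrable.
  apply: le_integrable Uei => //.
    by apply/measurable_EFinP; exact: measurable_funM.
  move=> t _ /=; rewrite lee_fin !normrM mulrC ler_wpM2r //.
  by apply: le_trans (hU j t) _; exact: ler_norm.
have e2i : P.-integrable setT (EFin \o (fun t => eps t ^+ 2)).
  have [wi _] := weighted_sqr_bound tau0 meps sg.
  apply: le_integrable wi => //; first by apply/measurable_EFinP; exact: measurable_funX.
  move=> t _ /=; rewrite lee_fin ger0_norm ?sqr_ge0 //; apply: le_trans (ler_norm _).
  by rewrite ler_peMr ?sqr_ge0 // -expR0 ler_expR mulr_ge0.
have h2i j : P.-integrable setT (EFin \o (fun t => h j t ^+ 2)).
  apply: (@bounded_integrable _ _ _ _ _ (U ^+ 2)); first exact: measurable_funX.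
  by move=> t; rewrite normrX lerXn2r ?nnegrE.
(* First-order optimality of [betastar], perturbed along its coordinate [j]. *)
have eh0 j : \int[P]_t (eps t * h j t) = 0.
  apply: integral_orthogonal_of_min => // s.
  apply: le_trans (opt (fun k => betastar k + s * (k == j)%:R)) _.
  rewrite le_eqVlt; apply/orP; left; apply/eqP; apply: eq_Rintegral => t _.
  have -> : h j t = \sum_k (k == j)%:R * h k t.
    rewrite (bigD1 j) //= eqxx mul1r big1 ?addr0 //.
    by move=> k /negbTE ->; rewrite mul0r.
  by rewrite /lincomb lincomb_shift /eps /lincomb; ring.
have [S HS] := whitening (gramT P h) (gram_pos mh hU indep).
pose x t := S *m hvec h t.
have xE j t : x t j ord0 = lincomb (S j) h t by exact: whitened_coord.
pose M := \sum_j (\sum_k `|S j k|) * U.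
have mx j : measurable_fun setT (fun t => x t j ord0).
  by under eq_fun do rewrite xE; exact: measurable_lincomb.
have xM j t : `|x t j ord0| <= M.
  rewrite xE; apply: le_trans (lincomb_le hU (S j) t) _.
  rewrite /M [leRHS](bigD1 j) //= lerDl sumr_ge0 // => k _.
  by rewrite mulr_ge0 // sumr_ge0.
have xI a b : \int[P]_t (x t a ord0 * x t b ord0) = (a == b)%:R.
  by rewrite (whitened_cov P mh hU) HS mxE.
have xB t : dotp (x t) (x t) <= B by exact: (whitened_le_Bconst hU).
have x0 j : \int[P]_t x t j ord0 = 0.
  transitivity (\int[P]_t (1 * lincomb (S j) h t)).
    by apply: eq_Rintegral => t _; rewrite xE mul1r.
  have h1 k : (fun t => 1 * h k t) = h k by apply/funext => t; rewrite mul1r.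
  rewrite (@integral_lincomb _ _ _ P _ h (cst 1)); last by move=> k; rewrite /cst h1.
  by apply: big1 => k _; rewrite /cst h1 -[X in _ * X]/(PE P (h k)) hP mulr0.
have ex0 j : \int[P]_t (eps t * x t j ord0) = 0.
  transitivity (\int[P]_t (eps t * lincomb (S j) h t)).
    by apply: eq_Rintegral => t _; rewrite xE.
  by rewrite integral_lincomb //; apply: big1 => k _; rewrite eh0 mulr0.
(* The mean of [dotp (x t) (x t)] is the trace of the identity covariance, and [B] bounds it
   pointwise. *)
have mB : m%:R <= B.
  have xxi j : P.-integrable setT (EFin \o (fun t => x t j ord0 * x t j ord0)).
    apply: (@bounded_integrable _ _ _ _ _ (M * M)); first exact: measurable_funM.
    by move=> t; rewrite normrM; apply: ler_pM.
  have -> : m%:R = \int[P]_t dotp (x t) (x t).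
    rewrite Rintegral_sum // (eq_bigr (fun=> 1)) ?sumr_const ?card_ord //.
    by move=> j _; rewrite xI eqxx.
  rewrite -[leRHS](Rintegral_cstT P); apply: le_Rintegral => //.
  - exact: integrable_sumr.
  - by apply: (@bounded_integrable _ _ _ _ _ `|B|) => //; exact: measurable_cst.
have m1 : 1 <= m%:R :> R by rewrite ler1n.
have B1 : 1 <= B by exact: le_trans mB.
have B0 : 0 < B by exact: lt_le_trans B1.
set l := ln (4 / delta) in nm *; set L4 := ln (4 * m%:R / delta) in nB.
set L8 := ln (8 * m%:R / delta); set L := ln (8 / delta).
have [l43 lL4 L8L4 LL8 L0] := log_levels d0 d1 m1.
rewrite -/l -/L4 -/L8 -/L in l43 lL4 L8L4 LL8 L0.
have l0 : 0 < l by apply: lt_le_trans l43.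
have L80 : 0 < L8 by apply: lt_le_trans LL8.
have mp : 0 < m%:R :> R by rewrite ltr0n.
have np : 0 < n%:R :> R by apply: lt_le_trans nm; rewrite !mulr_gt0.
have n0 : (0 < n)%N by rewrite ltr0n in np.
have eL (a : R) : 0 < a -> expR (- ln a) = a^-1 by move=> a0; rewrite expRN lnK ?posrE.
have [bad1 [mb1 Q1] H1] := noise_tail iidX n0 tau0 meps sg L0.
have nL8 : 12 * m%:R * L8 <= n%:R.
  have h1 : m%:R * L8 <= m%:R * (3 / 2 * L4) by rewrite ler_pM2l.
  have h2' : m%:R * L4 <= B * L4 by rewrite ler_wpM2r // (le_trans (ltW l0)).
  clear - h1 h2' nB; lra.
have [bad2 [mb2 Q2] H2] := cross_tail iidX n0 tau0 meps sg m0 B0 mx xM xB ex0 L80 nL8.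
have nBl : 18 * B * l <= n%:R.
  by apply: le_trans nB; rewrite ler_pM2l // mulr_gt0.
have [bad3 [mb3 Q3] H3] := mean_tail iidX n0 m0 mx xM xI xB x0 l43 nBl.
have [bad4 [mb4 Q4] H4] := gram_tail iidX n0 mx xM xI xB B1.
(* The levels in the logarithms give each event [delta / 4]: the two-sided bounds for [eps] and for
   [m] coordinates are why [8 / delta] and [8 * m / delta] occur. *)
have q1 : (Q bad1 <= (delta / 4)%:E)%E.
  apply: le_trans Q1 _; rewrite lee_fin eL ?divr_gt0 // invf_div; clear; lra.
have q2 : (Q bad2 <= (delta / 4)%:E)%E.
  by apply: le_trans Q2 _; rewrite lee_fin eL ?divr_gt0 ?mulr_gt0 // cross_prob_le.
have q3 : (Q bad3 <= (delta / 4)%:E)%E.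
  by apply: le_trans Q3 _; rewrite lee_fin eL ?divr_gt0 // invf_div.
have q4 : (Q bad4 <= (delta / 4)%:E)%E.
  apply: le_trans Q4 _; rewrite lee_fin.
  by apply: (gram_prob_le B0 mp d0 _ erefl nB); apply: le_trans l43 lL4.
pose bad := bad1 `|` bad2 `|` (bad3 `|` bad4).
have mbad : measurable bad by do 2! apply: measurableU => //; apply: measurableU.
have Qbad : (Q bad <= delta%:E)%E.
  have -> : delta%:E = ((delta / 4)%:E + (delta / 4)%:E + ((delta / 4)%:E + (delta / 4)%:E))%E.
    by rewrite -!EFinD; congr EFin; clear; lra.
  apply: le_trans (measureU2 _ _ _) _; try exact: measurableU.
  apply: leeD; (apply: le_trans (measureU2 _ _ _) _ => //; exact: leeD).
(* The event depends on the sample alone and is fixed before any minimiser is chosen, so it serves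
   all minimisers and needs no measurable selection. *)
exists (~` bad); split; first exact: measurableC.
split.
  by rewrite probability_setC //; apply: leeB.
move=> w nbad alpha beta ols.
have nb1 : ~ bad1 w by move=> b; apply: nbad; left; left.
have nb2 : ~ bad2 w by move=> b; apply: nbad; left; right.
have nb3 : ~ bad3 w by move=> b; apply: nbad; right; left.
have nb4 : ~ bad4 w by move=> b; apply: nbad; right; right.
pose c : 'cV[R]_m := \col_j (beta j - betastar j).
have Su : S^T \in unitmx.
  by case: (mulmx1_unit HS).
(* The coefficient error [beta - betastar] in whitened coordinates: [g.(S h)] equals its combination
   of the variates. *)
pose g := invmx S^T *m c.
have gx t : dotp g (x t) = lincomb (fun j => beta j - betastar j) h t.
  rewrite /x dotp_mulmx /g mulKVmx // /dotp; apply: eq_bigr => j _.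
  by rewrite !mxE.
have res i : f (X i w) - alpha - lincomb beta h (X i w) =
    eps (X i w) - (alpha - PE P f) - dotp g (x (X i w)).
  rewrite gx /eps.
  have -> : lincomb (fun j => beta j - betastar j) h (X i w) =
      lincomb beta h (X i w) - lincomb betastar h (X i w).
    by rewrite -sumrB; apply: eq_bigr => j _; ring.
  ring.
(* The scales of the empirical means of [y] and of [eps y / tau]; [p * q] is the second-order
   rate. *)
pose p := Num.sqrt (m%:R * l / n%:R); pose q := Num.sqrt (B * L8 / n%:R).
have p2 : p ^+ 2 = m%:R * l / n%:R.
  by rewrite sqr_sqrtr // divr_ge0 ?mulr_ge0 // ltW.
have q2' : q ^+ 2 = B * L8 / n%:R.
  by rewrite sqr_sqrtr // divr_ge0 ?mulr_ge0 // ltW.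
have sn0 : 0 < Num.sqrt n%:R :> R by rewrite sqrtr_gt0.
have sn2 : Num.sqrt n%:R ^+ 2 = n%:R :> R by rewrite sqr_sqrtr // ltW.
have pq : p * q = Num.sqrt (B * m%:R * L8 * l) / n%:R.
  rewrite sqrt_rate_mul ?mulr_ge0 ?(ltW l0) ?(ltW B0) ?(ltW L80) //.
  by congr (Num.sqrt _ / _); ring.
have -> : 58 * Num.sqrt (B * m%:R * L8 * l) * tau / n%:R = 58 * p * q * tau.
  by rewrite -(mulrA 58 p q) pq; ring.
have p75 : p ^+ 2 <= 1 / 75.
  rewrite p2 ler_pdivrMr //; clear - nm; lra.
apply: (least_squares_bound (eps := fun i => eps (X i w)) (y := fun i => x (X i w)) (g := g)) => //.
- exact: sqrtr_ge0.
- exact: sqrtr_ge0.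
- exact: H4.
- by apply: etrans (ols_sum_residuals ols); apply: eq_bigr => i _; rewrite res.
- apply: etrans (ols_orthogonal ols (fun j => beta j - betastar j)); apply: eq_bigr => i _.
  by rewrite res gx.
- apply: le_trans (H3 w nb3) _.
  have -> : (11 / 4 * p * n%:R) ^+ 2 = (11 / 4) ^+ 2 * p ^+ 2 * n%:R ^+ 2 by ring.
  by rewrite p2 le_eqVlt; apply/orP; left; apply/eqP; field; rewrite gt_eqF.
- apply: le_trans (H2 w nb2) _.
  have -> : (4 * q * tau * n%:R) ^+ 2 = 16 * q ^+ 2 * tau ^+ 2 * n%:R ^+ 2 by ring.
  by rewrite q2' le_eqVlt; apply/orP; left; apply/eqP; field; rewrite gt_eqF.
- apply: le_trans (H1 w nb1) _.
  rewrite -[X in _ <= _ * X]sn2 le_eqVlt; apply/orP; left; apply/eqP; field.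
  by rewrite gt_eqF.
- have -> : Num.sqrt (2 * L) * tau / Num.sqrt n%:R * p * (11 / 4) =
      Num.sqrt (2 * L) / Num.sqrt n%:R * p * (11 / 4) * tau by ring.
  rewrite ler_pM2r //; apply: (noise_rate_le np (ltW L0) _ _ _ p75 q2').
  - by apply: le_trans LL8 _; rewrite ler_peMl // ltW.
  - exact: sqrtr_ge0.
  - exact: sqrtr_ge0.
Qed.
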